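(* Let $\mathbb{X}$ be a finite-dimensional Euclidean space, $\mathbb{A},\mathbb{B}$ nonempty compact subsets of finite-dimensional Euclidean spaces, and $f:\mathbb{X}\times\mathbb{A}\times\mathbb{B}\to\mathbb{X}$, $g:\mathbb{X}\times\mathbb{A}\times\mathbb{B}\to[0,1]$ continuous with $\|f(x,a,b)-f(y,a,b)\|+|g(x,a,b)-g(y,a,b)|\le L\|x-y\|$ for some $L>0$ and all $x,y,a,b$. For $x_*\in\mathbb{X}$ and Borel measurable bounded controls $a:\mathbb{R}_+\to\mathbb{A}$, $b:\mathbb{R}_+\to\mathbb{B}$ let $y(\cdot;x_*,a,b)$ be the solution of $\dot x=f(x,a(t),b(t))$, $x(0)=x_*$. Let $\Omega\subset\mathbb{X}$ be nonempty and strongly invariant: $y(t;x_*,a,b)\in\Omega$ for all $x_*\in\Omega$, $t\ge0$ and all such controls $a,b$. For $\varrho\in\mathfrak{D}$, $x_*\in\Omega$ define $$\mathcal{V}[\varrho](x_* )=\inf_{\alpha\in\mathcal{A}}\sup_{b}\int_0^\infty\varrho(t)g\big(y(t;x_*,\alpha(b),b),\alpha(b)(t),b(t)\big)dt,$$ the supremum being over all Borel measurable bounded $b:\mathbb{R}_+\to\mathbb{B}$. Then for every $U_*:\Omega\to[0,1]$ the following are equivalent: (c) for every density $\mu\in\mathfrak{D}$ piecewise continuous on $(0,\infty)$, $\lim_{\lambda\to+0}\sup_{\omega\in\Omega}|\mathcal{V}[\mu^\lambda_{\mathrm{scale}}](\omega)-U_*(\omega)|=0$; (u) $\lim_{T\to+\infty}\sup_\omega|\mathcal{V}[\varpi_T](\omega)-U_*(\omega)|=0$;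 (e) $\lim_{\lambda\to+0}\sup_\omega|\mathcal{V}[\pi_\lambda](\omega)-U_*(\omega)|=0$; (p) for some power density $\varrho\in\mathfrak{D}$, $\lim_{T\to+\infty}\sup_\omega|\mathcal{V}[\varrho^T_{\mathrm{shift}}](\omega)-U_*(\omega)|=0$; (q) this holds for every power density $\varrho\in\mathfrak{D}$. Moreover, if for some $\mu\in\mathfrak{D}$ piecewise continuous on $(0,\infty)$ and some power density $\varrho$ one of the limits $\lim_{T\to\infty}\mathcal{V}[\varpi_T]$, $\lim_{\lambda\to+0}\mathcal{V}[\pi_\lambda]$, $\lim_{T\to\infty}\mathcal{V}[\varrho^T_{\mathrm{shift}}]$ exists uniformly on $\Omega$, then these and $\lim_{\lambda\to+0}\mathcal{V}[\mu^\lambda_{\mathrm{scale}}]$ all exist uniformly on $\Omega$, coincide and do not depend on the choice of $\mu$ and $\varrho$.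
   Context: $\mathbb{R}_+=[0,\infty)$. A quasistrategy (Elliott–Kalton strategy) of the first player is a map $\alpha$ from the set of Borel measurable bounded $b:\mathbb{R}_+\to\mathbb{B}$ to the set of Borel measurable bounded $a:\mathbb{R}_+\to\mathbb{A}$ such that for every $t>0$, $b|_{[0,t]}=b'|_{[0,t]}$ implies $\alpha[b]|_{[0,t]}=\alpha[b']|_{[0,t]}$; $\mathcal{A}$ is the set of all quasistrategies. $\mathfrak{D}$: probability densities $\varrho:\mathbb{R}_+\to\mathbb{R}_+$. For $T>0$ with $\int_T^\infty\varrho>0$: $\varrho^T_{\mathrm{shift}}(t)=\varrho(t+T)/\int_T^\infty\varrho$; for $\lambda>0$: $\varrho^\lambda_{\mathrm{scale}}(t)=\lambda\varrho(\lambda t)$. $\varpi_T(t)=\frac1T1_{[0,T]}(t)$, $\pi_\lambda(t)=\lambda e^{-\lambda t}$. A power density is $\varrho\in\mathfrak{D}$ with $\varrho(t)=(\alpha+\beta t)^{-\gamma}$ for some $\alpha,\beta,\gamma>0$. *)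

(* Defs.v *)
From HB Require Import structures.
From mathcomp Require Import all_boot all_order all_algebra.
From mathcomp Require Import all_classical all_reals all_analysis.
From Stdlib Require Import ClassicalEpsilon.
Set Implicit Arguments. Unset Strict Implicit. Unset Printing Implicit Defensive.
Import Order.TTheory GRing.Theory Num.Theory.
Import numFieldNormedType.Exports.
Local Open Scope classical_set_scope.
Local Open Scope ring_scope.

Section Defs.
Variable R : realType.
Local Notation leb := (@lebesgue_measure R).

Definition Rplus : set R := [set t | 0 <= t].

(** Borel measurability of a map into R^k (= 'rV[R]_k), via its coordinates
    (the Borel sigma-algebra of R^k is the product of the coordinate ones). *)
Definition borel_vec (k : nat) (D : set R) (a : R -> 'rV[R]_k) : Prop :=
  forall i : 'I_k, measurable_fun D (fun t => a t ord0 i).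

Definition control (k : nat) (K : set 'rV[R]_k) (a : R -> 'rV[R]_k) : Prop :=
  (forall t, 0 <= t -> K (a t)) /\ borel_vec Rplus a /\
  exists M : R, forall t, 0 <= t -> `|a t| <= M.

Definition quasistrategy (p q : nat) (A : set 'rV[R]_p) (B : set 'rV[R]_q)
  (alpha : (R -> 'rV[R]_q) -> (R -> 'rV[R]_p)) : Prop :=
  (forall b, control B b -> control A (alpha b)) /\
  (forall b b' t, control B b -> control B b' -> 0 < t ->
     (forall s, 0 <= s <= t -> b s = b' s) ->
     forall s, 0 <= s <= t -> alpha b s = alpha b' s).

(** y is a (Caratheodory) solution of x' = f(x, a(t), b(t)), x(0) = x0 on R_+. *)
Definition is_solution (n p q : nat)
  (f : 'rV[R]_n -> 'rV[R]_p -> 'rV[R]_q -> 'rV[R]_n)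
  (x0 : 'rV[R]_n) (a : R -> 'rV[R]_p) (b : R -> 'rV[R]_q) (y : R -> 'rV[R]_n) : Prop :=
  forall t, 0 <= t -> forall i : 'I_n,
    leb.-integrable [set s : R | (0 <= s <= t)%R] (fun s => ((f (y s) (a s) (b s)) ord0 i)%:E) /\
    (\int[leb]_(s in [set s : R | (0 <= s <= t)%R]) ((f (y s) (a s) (b s)) ord0 i)%:E =
       ((y t ord0 i) - (x0 ord0 i))%:E)%E.

(** the solution y(.; x0, a, b) (unique under the standing hypotheses) *)
Definition traj (n p q : nat)
  (f : 'rV[R]_n -> 'rV[R]_p -> 'rV[R]_q -> 'rV[R]_n)
  (x0 : 'rV[R]_n) (a : R -> 'rV[R]_p) (b : R -> 'rV[R]_q) : R -> 'rV[R]_n :=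
  epsilon (inhabits (fun _ => x0)) (is_solution f x0 a b).

Definition density (rho : R -> R) : Prop :=
  (forall t, 0 <= t -> 0 <= rho t) /\ measurable_fun Rplus rho /\
  (\int[leb]_(t in Rplus) (rho t)%:E = 1)%E.

Definition rho_shift (rho : R -> R) (T : R) : R -> R :=
  fun t => rho (t + T) / fine (\int[leb]_(s in [set s | T <= s]) (rho s)%:E).

Definition rho_scale (rho : R -> R) (lam : R) : R -> R :=
  fun t => lam * rho (lam * t).

Definition varpi (T : R) : R -> R := fun t => if (0 <= t <= T) then T^-1 else 0.

Definition pi_exp (lam : R) : R -> R := fun t => lam * expR (- (lam * t)).

Definition power_density (rho : R -> R) : Prop :=
  density rho /\ exists al be ga : R, 0 < al /\ 0 < be /\ 0 < ga /\
    forall t, 0 <= t -> rho t = (al + be * t) `^ (- ga).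

Definition piecewise_continuous (rho : R -> R) : Prop :=
  forall u v : R, 0 < u -> u <= v ->
    exists s : seq R,
      (forall t, u <= t <= v -> t \notin s -> {for t, continuous rho}) /\
      (forall t, t \in s -> (exists l : R, rho x @[x --> t^'-] --> l) /\
                            (exists l : R, rho x @[x --> t^'+] --> l)).

Definition payoff (n p q : nat)
  (f : 'rV[R]_n -> 'rV[R]_p -> 'rV[R]_q -> 'rV[R]_n)
  (g : 'rV[R]_n -> 'rV[R]_p -> 'rV[R]_q -> R)
  (rho : R -> R) (x0 : 'rV[R]_n) (a : R -> 'rV[R]_p) (b : R -> 'rV[R]_q) : \bar R :=
  \int[leb]_(t in Rplus) (rho t * g (traj f x0 a b t) (a t) (b t))%:E.

Definition value (n p q : nat) (A : set 'rV[R]_p) (B : set 'rV[R]_q)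
  (f : 'rV[R]_n -> 'rV[R]_p -> 'rV[R]_q -> 'rV[R]_n)
  (g : 'rV[R]_n -> 'rV[R]_p -> 'rV[R]_q -> R)
  (rho : R -> R) (x0 : 'rV[R]_n) : R :=
  fine (ereal_inf [set ereal_sup [set payoff f g rho x0 (alpha b) b | b in control B]
                  | alpha in quasistrategy A B]).

Definition sup_dev (n : nat) (Om : set 'rV[R]_n) (F U : 'rV[R]_n -> R) : \bar R :=
  ereal_sup [set (`|F w - U w|)%:E | w in Om].

End Defs.

(* Main.v *)
Require Import Defs.
From HB Require Import structures.
From mathcomp Require Import all_boot all_order all_algebra.
From mathcomp Require Import all_classical all_reals all_analysis measurable_realfun.
From mathcomp Require Import ring lra.
From Stdlib Require Import ClassicalEpsilon.
Set Implicit Arguments. Unset Strict Implicit. Unset Printing Implicit Defensive.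
Import Order.TTheory GRing.Theory Num.Theory.
Import numFieldNormedType.Exports.
Local Open Scope classical_set_scope.
Local Open Scope ring_scope.

(** The value [V[r]] makes sense for every integrable weight [r >= 0]; it is positively
    homogeneous and 1-Lipschitz in the L1 norm. Switching strategies at a time [h] gives the only
    game-theoretic input: [|V[r] - V[r']|] is at most the L1 distance of [r] and [r'] on [[0, h]]
    plus the uniform distance of the values of the shifted weights [r(. + h)], [r'(. + h)].

    Uniform densities imply all densities: approximate the density in L1 by a positive step
    function. A step of height [c] followed by a tail of mass [m] is compared with the single box of
    height [c] and the same total mass, whose value is known; induct on the number of steps.

    Conversely, exponential and power densities reproduce themselves, up to scaling, under
    shifts. Cut [[0, N tau]] into [N] blocks. With [k] blocks left, compare the box with [k] times the
    scaled density that has the same height at 0: they differ on one block by [O(1/k)], and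
    both tails are again of the same kind. The errors sum to [O(log N)] against a total mass [N]. *)

(** * Measurability and change of variables *)

(** The comparison across a time [h] takes a supremum over all states of [Om], so nothing has to be
    known about the state reached; strong invariance keeps it in [Om]. Its error on [[0, h]] is an
    L1 distance, so the competitor is always chosen with the same height at 0. This is why step
    heights must be positive (mass [m] at height [c] needs length [m / c]), and why the converse
    asks for [mu0 * (1 - C * t) <= mu t <= mu0]: with [k] blocks left, one block is a time
    [1 / (k * mu0)] of the density, hence the loss [O(1/k)]. A bound cruder than the logarithm
    suffices, as the sum only has to be small against [N]. Two technical points shape many
    statements. At the switching time the old control still acts, so pasted and shifted controls
    agree only at positive times; uniqueness and payoffs are therefore stated so as to ignore time
    0. And [traj] is a choice among solutions, so existence and uniqueness for right sides merely
    measurable in time come before the game. For power densities, shifting and scaling are one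
    operation with different parameters, which brings [rho_shift] under the result for
    [rho_scale]. *)

Section AffineChangeOfVariables.
Variable R : realType.
Local Notation leb := (@lebesgue_measure R).
Implicit Types (l h : R) (D : set R).

Lemma measurable_affine l h :
  measurable_fun setT ((fun t => l * t + h) : R -> measurableTypeR R).
Proof. by apply: measurable_funD => //; apply: measurable_funM. Qed.

(** The push-forward of Lebesgue measure under the affine map, multiplied by [l], gives every
    half-open interval its length, and this characterises Lebesgue measure. *)
Lemma lebesgue_measure_affine l h D : 0 < l -> measurable D ->
  (leb D = l%:E * leb ((fun t => (l * t + h)%R) @^-1` D))%E.
Proof.
move=> l0 mD; have mphi := measurable_affine l h.
pose phi : R -> measurableTypeR R := fun t => l * t + h.
pose M : {measure set (measurableTypeR R) -> \bar R} :=
  mscale (NngNum (ltW l0)) (pushforward leb phi).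
rewrite -[RHS]/(M mphi D).
apply: lebesgue_measure_unique => // _ [[a b]] _ <-.
rewrite /M /= /mscale /= /pushforward.
have -> : phi @^-1` `]a, b]%classic = `](a - h) / l, (b - h) / l]%classic.
  apply/seteqP; split=> t /=; rewrite !in_itv /= /phi ltr_pdivrMr // ler_pdivlMr //
    (mulrC t) ltrBlDr lerBrDr //.
rewrite !lebesgue_measure_itv/= !lte_fin ltr_pM2r ?invr_gt0 // ltrD2r.
case: ifP => ab; last by rewrite mule0.
by rewrite -!EFinD -EFinM; congr _%:E; field; rewrite gt_eqF.
Qed.

Lemma ge0_integral_affine l h D (F : R -> \bar R) : 0 < l -> measurable D ->
  measurable_fun D F -> (forall t, D t -> 0 <= F t)%E ->
  (\int[leb]_(t in D) F t =
   l%:E * \int[leb]_(t in (fun t => (l * t + h)%R) @^-1` D) F (l * t + h)%R)%E.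
Proof.
move=> l0 mD mF F0.
have mphi := measurable_affine l h.
pose phi : R -> measurableTypeR R := fun t => l * t + h.
have F0' : {in D, forall y, 0 <= F y}%E by move=> y /set_mem /F0.
have /= <- := @ge0_integral_pushforward _ _ (measurableTypeR R) (measurableTypeR R) R phi mphi
  (@lebesgue_measure R) D F mD mF F0'.
pose M : {measure set (measurableTypeR R) -> \bar R} :=
  pushforward leb phi.
have /= <- := @ge0_integral_mscale _ (measurableTypeR R) R (M mphi) D mD (NngNum (ltW l0)) F mF F0.
apply: eq_measure_integral => X mX _.
exact: lebesgue_measure_affine.
Qed.

(** No integrability is asked: positive and negative parts are translated separately, and the
    integral is their difference. *)
Lemma integral_shift h D (F : R -> \bar R) : measurable D -> measurable_fun D F ->
  (\int[leb]_(t in D) F t =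
   \int[leb]_(t in (fun t => (t + h)%R) @^-1` D) F (t + h)%R)%E.
Proof.
move=> mD mF.
have ge0 (G : R -> \bar R) : measurable_fun D G -> (forall t, 0 <= G t)%E ->
    (\int[leb]_(t in D) G t =
     \int[leb]_(t in (fun t => (t + h)%R) @^-1` D) G (t + h)%R)%E.
  move=> mG G0; rewrite (@ge0_integral_affine 1 h D) ?mul1e //.
  have -> : (fun t : R => 1 * t + h) = (fun t => t + h).
    by apply/funext => t; rewrite mul1r.
  by apply: eq_integral => t _; rewrite mul1r.
rewrite integralE [RHS]integralE; congr (_ - _)%E.
- rewrite (ge0 _ (measurable_funepos mF) (funepos_ge0 F)).
  by apply: eq_integral => t _; rewrite !funeposE.
- rewrite [LHS](ge0 _ (measurable_funeneg mF) (funeneg_ge0 F)).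
  by apply: eq_integral => t _; rewrite !funenegE.
Qed.

Lemma measurable_fun_affine d (T : measurableType d) l h D (F : R -> T) :
  measurable D -> measurable_fun D F ->
  measurable_fun ((fun t => l * t + h) @^-1` D) (fun t => F (l * t + h)).
Proof.
move=> mD mF; have mphi := measurable_affine l h.
apply: (@measurable_comp _ _ _ _ _ _ D F _ (fun t => l * t + h)) => //.
- by move=> _ [t /= Dt <-].
- exact: measurable_funS mphi.
Qed.

End AffineChangeOfVariables.

(** * Borel maps composed with functions continuous on the states times [A] times [B] *)

Section MeasurableComposition.
Variable R : realType.

(** Half-open cubes of side [1 / (k + 1)]: a countable family, fine enough to exhaust open sets,
    with measurable preimages under coordinatewise Borel maps. *)
Definition cell (m : nat) (k : nat) (c : 'rV[int]_m) : set 'rV[R]_m :=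
  [set x | forall i, (c ord0 i)%:~R <= k.+1%:R * x ord0 i < (c ord0 i)%:~R + 1].

Lemma measurable_preimage_cell m k (c : 'rV[int]_m) (D : set R) (x : R -> 'rV[R]_m) :
  measurable D -> borel_vec D x -> measurable (D `&` [set t | cell k c (x t)]).
Proof.
move=> mD mx.
have -> : D `&` [set t | cell k c (x t)] = D `&` \bigcap_(i in [set: 'I_m])
    (D `&` (fun t => k.+1%:R * x t ord0 i) @^-1` `[(c ord0 i)%:~R, (c ord0 i)%:~R + 1[%classic).
  apply/seteqP; split=> t [Dt] /= Ht; split=> // i.
    by move=> _; split=> //=; rewrite in_itv /=; exact: Ht.
  by have [_ /=] := Ht i I; rewrite in_itv.
apply: measurableI => //; apply: fin_bigcap_measurable => //.

move=> i _; apply: (measurable_funM (measurable_cst _) (mx i)) => //.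
Qed.

Lemma cell_floor m k (x : 'rV[R]_m) :
  cell k (\row_i Num.floor (k.+1%:R * x ord0 i)) x.
Proof.
by move=> i; rewrite mxE; have := floor_itv (k.+1%:R * x ord0 i); rewrite intrD.
Qed.

Lemma cell_ball m k (c : 'rV[int]_m) (x y : 'rV[R]_m) (e : R) :
  k.+1%:R^-1 <= e -> cell k c x -> cell k c y -> ball x e y.
Proof.
move=> ke cx cy; split.
  by apply: lt_le_trans ke; rewrite invr_gt0 ltr0n.
move=> i j; rewrite ord1 /ball /= /ball_; apply: lt_le_trans ke.
rewrite -[X in _ < X]mul1r ltr_pdivlMr ?ltr0n // mulrC.
rewrite -[k.+1%:R]ger0_norm ?ler0n // -normrM ltr_norml.
move: (cx j) (cy j) => /andP[c1 c2] /andP[c3 c4]; apply/andP; split; nra.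
Qed.

(** [F] is continuous only where the controls lie in [A] and [B], so the preimage of an open
    interval is the trace of an open set [W]. [W] is the union of the countably many products of
    cells inside it, and each product is handled by coordinates. *)
Lemma measurable_fun_comp_continuous n p q (A : set 'rV[R]_p) (B : set 'rV[R]_q)
  (F : 'rV[R]_n -> 'rV[R]_p -> 'rV[R]_q -> R) (D : set R)
  (y : R -> 'rV[R]_n) (a : R -> 'rV[R]_p) (b : R -> 'rV[R]_q) :
  {within [set z : 'rV[R]_n * 'rV[R]_p * 'rV[R]_q | A z.1.2 /\ B z.2],
     continuous (fun z => F z.1.1 z.1.2 z.2)} ->
  borel_vec D y -> borel_vec D a -> borel_vec D b ->
  (forall t, D t -> A (a t)) -> (forall t, D t -> B (b t)) ->
  measurable_fun D (fun t => F (y t) (a t) (b t)).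
Proof.
pose K := [set z : 'rV[R]_n * 'rV[R]_p * 'rV[R]_q | A z.1.2 /\ B z.2].
rewrite -/K => cF my ma mb Aa Bb mD.
apply: (measurability _ (RGenOpens.measurableE R)) => //.
move=> _ [_ [r [s ->] <-]].
have oI : open `]r, s[%classic by exact: interval_open.
have /continuousP/(_ _ oI)/open_subspaceP[W oW WE] := cF.
pose I : countType := (nat * 'rV[int]_n * 'rV[int]_p * 'rV[int]_q)%type.
pose C (i : I) : set ('rV[R]_n * 'rV[R]_p * 'rV[R]_q) :=
  [set z | [/\ cell i.1.1.1 i.1.1.2 z.1.1, cell i.1.1.1 i.1.2 z.1.2 &
               cell i.1.1.1 i.2 z.2]].
(* A condition not involving [t] selects the products inside [W], so that the union can run over a
   whole countable type. *)
have -> : D `&` (fun t => F (y t) (a t) (b t)) @^-1` `]r, s[%classic =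
   \bigcup_(i in [set: I]) ([set t | C i `<=` W] `&`
     ((D `&` [set t | cell i.1.1.1 i.1.1.2 (y t)]) `&`
      ((D `&` [set t | cell i.1.1.1 i.1.2 (a t)]) `&`
       (D `&` [set t | cell i.1.1.1 i.2 (b t)])))).
  apply/seteqP; split=> t.
    move=> [Dt Ft].
    have Kt : K (y t, a t, b t) by split; [exact: Aa|exact: Bb].
    have Wt : W (y t, a t, b t).
      have : (W `&` K) (y t, a t, b t) by rewrite WE; split.
      by case.
    have := oW; rewrite openE => /(_ _ Wt)/nbhs_ballP[e /= e0 eW].
    have [k ke] : exists k : nat, k.+1%:R^-1 < e.
      by exists (Num.truncn e^-1); rewrite invf_plt ?posrE // truncnS_gt.
    exists (k, \row_i Num.floor (k.+1%:R * y t ord0 i), \row_i Num.floor (k.+1%:R * a t ord0 i),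
            \row_i Num.floor (k.+1%:R * b t ord0 i)) => //; split.
      move=> [[y' a'] b'] [/= h1 h2 h3]; apply: eW; split; first split=> /=;
        by apply: (cell_ball (ltW ke) (cell_floor _ _)).
    by do 2 (split; [by split=> //; exact: cell_floor|]); split=> //; exact: cell_floor.
  move=> [i _ [CW [[Dt h1] [[_ h2] [_ h3]]]]]; split=> //.
  have Kt : K (y t, a t, b t) by split; [exact: Aa|exact: Bb].
  have : (W `&` K) (y t, a t, b t) by split=> //; apply: CW; split.
  by rewrite WE => -[].
apply: countable_bigcupT_measurable => [|i]; first exact: countableP.
apply: measurableI.
  have [CW|CW] := pselect (C i `<=` W).
    by rewrite (_ : [set _ | _] = setT) //; apply/seteqP; split.
  by rewrite (_ : [set _ | _] = set0) //; apply/seteqP; split.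
by apply: measurableI; [|apply: measurableI]; exact: measurable_preimage_cell.
Qed.

End MeasurableComposition.

(** * Caratheodory differential equations *)

Section ExpWeightedIntegrals.
Variable R : realType.
Local Notation leb := (@lebesgue_measure R).
Local Notation seg t := [set s : R | (0 <= s <= t)%R].

Lemma segE (t : R) : seg t = `[0, t]%classic.
Proof. by apply/seteqP; split=> s /=; rewrite in_itv. Qed.

Lemma measurable_seg (t : R) : measurable (seg t).
Proof. by rewrite segE; exact: measurable_itv. Qed.

Lemma RplusE : @Rplus R = `[0, +oo[%classic.
Proof. by apply/seteqP; split=> s /=; rewrite in_itv /= andbT. Qed.

Lemma measurable_Rplus : measurable (@Rplus R).
Proof. by rewrite RplusE; exact: measurable_itv. Qed.

Lemma segS_Rplus (t : R) : seg t `<=` @Rplus R.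
Proof. by move=> s /andP[]. Qed.

Lemma integral_expR (k t : R) : 0 < k -> 0 <= t ->
  (\int[leb]_(s in seg t) (expR (k * s))%:E = (k^-1 * (expR (k * t) - 1))%:E)%E.
Proof.
move=> k0; rewrite le_eqVlt => /predU1P[<-|t0].
  by rewrite segE set_itv1 integral_set1 mulr0 expR0 subrr mulr0.
have dF (x : R) : is_derive x (1:R) (fun s => k^-1 * expR (k * s)) (expR (k * x)).
  apply: is_derive_eq; rewrite /GRing.scale /=.
  by rewrite mulr1 mulrCA mulVf ?mulr1 // gt_eqF.
have cE : continuous (fun s : R => expR (k * s)).
  by move=> x; apply: continuous_comp; [exact: mulrl_continuous|exact: continuous_expR].
have cF : continuous (fun s : R => k^-1 * expR (k * s)).
  by move=> x; apply: cvgMr; exact: cE.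
rewrite segE (@continuous_FTC2 _ _ (fun s => k^-1 * expR (k * s))) //.
- by rewrite mulr0 expR0 -EFinB mulrBr.
- exact: continuous_subspaceT.
- split.
  + by move=> x _; have [] := dF x.
  + by apply: cvg_at_right_filter; exact: cF.
  + by apply: cvg_at_left_filter; exact: cF.
- by move=> x _; rewrite derive1E; have [_ ->] := dF x.
Qed.

(** The bound is asked only for [0 < s], to serve right sides that agree off time 0. The factor
    [1 / k] gained by integrating the exponential is the source of all contractions below. *)
Lemma integral_expR_bound (G : R -> R) (c k t : R) : 0 < k -> 0 <= c -> 0 <= t ->
  measurable_fun (seg t) G ->
  (forall s, 0 < s <= t -> `|G s| <= c * expR (k * s)) ->
  leb.-integrable (seg t) (EFin \o G) /\
  `|\int[leb]_(s in seg t) G s| <= c / k * expR (k * t).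
Proof.
move=> k0 c0 t0 mG Gc.
have mE D : measurable_fun D (fun s : R => expR (k * s)).
  by apply: measurableT_comp => //; exact: mulrl_measurable.
have le : (\int[leb]_(s in seg t) `|G s|%:E <= (c / k * expR (k * t))%:E)%E.
  have e : (\int[leb]_(s in seg t) (c * expR (k * s))%:E <= (c / k * expR (k * t))%:E)%E.
    under eq_integral do rewrite EFinM.
    rewrite ge0_integralZl_EFin //.
    + rewrite integral_expR // -EFinM lee_fin mulrA ler_wpM2l //.
        by rewrite divr_ge0 // ltW.
      by rewrite gerBl.
    + exact: measurable_seg.
    + by apply/measurable_EFinP; exact: mE.
  apply: le_trans e; rewrite segE.
  have S : `]0, t]%classic `<=` seg t.
    by move=> s /=; rewrite in_itv /= => /andP[/ltW -> ->].
  have mG' : measurable_fun `]0, t]%classic (fun s => `|G s|).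
    by apply: measurableT_comp => //; apply: measurable_funS mG => //; exact: measurable_seg.
  rewrite -!(@integral_itv_obnd_cbnd R 0 (BRight t)); last 2 first.
  - by apply/measurable_EFinP; apply: measurable_funM => //; exact: mE.
  - exact/measurable_EFinP.
  apply: ge0_le_integral => //.
  - exact/measurable_EFinP.
  - by apply/measurable_EFinP; apply: measurable_funM => //; exact: mE.
have iG : leb.-integrable (seg t) (EFin \o G).
  apply/integrableP; split; first exact/measurable_EFinP.
  by apply: le_lt_trans le _; rewrite ltry.
split => //; have mseg := measurable_seg t.
rewrite -lee_fin; apply: le_trans le.
rewrite -[leRHS]fineK; last first.
  apply: (@integrable_fin_num _ _ _ leb _ mseg (fun s => (`|G s|)%:E)).
  exact: integrable_norm.
rewrite lee_fin; exact: le_normr_Rintegral.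
Qed.

(** On each [[0, N]] the indefinite integral is continuous, hence measurable. *)
Lemma borel_integral (G : R -> R) :
  (forall t, 0 <= t -> leb.-integrable (seg t) (EFin \o G)) ->
  measurable_fun (@Rplus R) (fun t => \int[leb]_(s in seg t) G s).
Proof.
move=> iG.
have -> : @Rplus R = \bigcup_(N in [set: nat]) `[0, N%:R]%classic.
  apply/seteqP; split=> t.
    move=> t0; exists (Num.truncn t).+1 => //=; rewrite in_itv /=; apply/andP; split=> //.
    exact/ltW/truncnS_gt.
  by move=> [N _] /=; rewrite in_itv /= => /andP[].
apply/measurable_fun_bigcup => [N|N]; first exact: measurable_itv.
apply: subspace_continuous_measurable_fun => //.
rewrite (_ : (fun t => _) = (fun t => \int[leb]_(s in `[0, t]) G s)); last first.
  by apply/funext => t; rewrite segE.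
apply: parameterized_integral_continuous; rewrite ?ler0n // -segE.
by apply: iG.
Qed.

End ExpWeightedIntegrals.

Section Caratheodory.
Variable R : realType.
Local Notation leb := (@lebesgue_measure R).
Local Notation seg t := [set s : R | (0 <= s <= t)%R].

Lemma coord_le_norm n (x : 'rV[R]_n) i : `|x ord0 i| <= `|x|.
Proof.
rewrite [leRHS]/Num.Def.normr /= mx_normrE; apply/bigmax_geP; right => /=.
by exists (ord0, i).
Qed.

Lemma norm_le_coord n (x : 'rV[R]_n) c : 0 <= c -> (forall i, `|x ord0 i| <= c) -> `|x| <= c.
Proof.
move=> c0 xc; rewrite [leLHS]/Num.Def.normr /= mx_normrE; apply/bigmax_leP; split=> // -[j i] _ /=.
by rewrite ord1.
Qed.

Lemma geometric_small (c e : R) : 0 < e -> exists k : nat, c * (2^-1) ^+ k < e.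
Proof.
move=> e0; exists (Num.truncn (c / e)).
set k := Num.truncn _.
have kc : c / e < (2 ^ k)%:R.
  by apply: lt_le_trans (truncnS_gt _) _; rewrite ler_nat ltn_expl.
have p0 : 0 < (2 ^ k)%:R :> R by rewrite ltr0n expn_gt0.
rewrite exprVn -natrX ltr_pdivrMr // mulrC.
by rewrite ltr_pdivrMr in kc.
Qed.

Lemma le0_geometric (x c : R) : (forall k, x <= c * (2^-1) ^+ k) -> x <= 0.
Proof.
move=> xc; rewrite leNgt; apply/negP => x0.
by have [k] := geometric_small c x0; rewrite ltNge xc.
Qed.

Definition sol_on n (T : R) (h : R -> 'rV[R]_n -> 'rV[R]_n) (x0 : 'rV[R]_n) (y : R -> 'rV[R]_n) :=
  forall t : R, 0 <= t <= T -> forall i,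
    leb.-integrable (seg t) (EFin \o (fun s => (h s (y s)) ord0 i)) /\
    \int[leb]_(s in seg t) (h s (y s)) ord0 i = y t ord0 i - x0 ord0 i.

(* Both trajectories satisfy [y - z = int (h y - h z)]; measured against the weight
   [expR (2 L t)] this integral operator contracts by 1/2. *)
Lemma sol_on_unique n (L T : R) (h h' : R -> 'rV[R]_n -> 'rV[R]_n) x0 y z : 0 < L ->
  (forall (s : R) x x', 0 < s <= T -> `|h s x - h s x'| <= L * `|x - x'|) ->
  (forall (s : R) x, 0 < s <= T -> h s x = h' s x) ->
  sol_on T h x0 y -> sol_on T h' x0 z -> forall t : R, 0 <= t <= T -> y t = z t.
Proof.
move=> L0 hL hh' Sy Sz t0 t0T.
have T0 : 0 <= T by case/andP: t0T => /le_trans; apply.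
pose G i s := h s (y s) ord0 i - h' s (z s) ord0 i.
have iG (t : R) i : 0 <= t <= T -> leb.-integrable (seg t) (EFin \o G i).
  move=> tT; have mt := measurable_seg t.
  have := (Sz t tT i).1; have := (Sy t tT i).1 => i1 i2.
  by have := @integrableB _ _ _ leb _ mt _ _ i1 i2.
have yz (t : R) i : 0 <= t <= T -> y t ord0 i - z t ord0 i = \int[leb]_(s in seg t) G i s.
  move=> tT; rewrite RintegralB; first last.
  - exact: (Sz t tT i).1.
  - exact: (Sy t tT i).1.
  - exact: measurable_seg.
  by rewrite (Sy t tT i).2 (Sz t tT i).2 opprB addrA subrK.
have TT : 0 <= T <= T by rewrite T0 lexx.
(* Start of the iteration: the total integral of all coordinates of the difference of drifts bounds
   the distance at every time up to [T]. *)
pose D := \sum_i \int[leb]_(s in seg T) `|G i s|.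
have D0 : 0 <= D by apply: sumr_ge0 => i _; apply: Rintegral_ge0.
have step k (t : R) : 0 <= t <= T -> `|y t - z t| <= D * (2^-1) ^+ k * expR (2 * L * t).
  elim: k t => [|k IH] t tT.
    have e1 : 1 <= expR (2 * L * t).
      by case/andP: tT => ? _; rewrite -expR0 ler_expR !mulr_ge0 // ltW.
    rewrite expr0 mulr1; apply: le_trans (_ : D <= _); last by rewrite ler_peMr.
    apply: norm_le_coord => // i; rewrite !mxE yz //.
    apply: le_trans (_ : \int[leb]_(s in seg T) `|G i s| <= _).
      apply: le_trans; first by apply: le_normr_Rintegral => //; [exact: measurable_seg|exact: iG].
      rewrite -lee_fin !fineK; first last.
      - apply: (@integrable_fin_num _ _ _ leb _ (measurable_seg t)).
        exact: (integrable_norm (iG t i tT)).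
      - apply: (@integrable_fin_num _ _ _ leb _ (measurable_seg T)).
        exact: (integrable_norm (iG T i TT)).
      apply: ge0_subset_integral => //; try exact: measurable_seg.
      + by have /integrableP[] := integrable_norm (iG T i TT).
      + by move=> s /= /andP[-> /le_trans]; apply; case/andP: tT.
    rewrite /D (bigD1 i) //= lerDl; apply: sumr_ge0 => j _; exact: Rintegral_ge0.
  apply: norm_le_coord => [|i].
    by rewrite !mulr_ge0 ?expR_ge0 // exprn_ge0.
  have [t0' tT'] := andP tT.
  rewrite !mxE yz //.
  (* The Lipschitz factor [L] over the rate [2 * L] of the weight leaves 1/2. *)
  have [|||||_] := @integral_expR_bound R (G i) (L * (D * (2^-1) ^+ k)) (2 * L) t.
  - by rewrite mulr_gt0.
  - by rewrite !mulr_ge0 // ?ltW // exprn_ge0.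
  - by [].
  - by have /integrableP[/measurable_EFinP] := iG t i tT.
  - move=> s /andP[s0 st].
    have sT : 0 < s <= T by rewrite s0 (le_trans st).
    rewrite /G -hh' //.
    have := coord_le_norm (h s (y s) - h s (z s)) i; rewrite !mxE => /le_trans; apply.
    apply: le_trans (hL _ _ _ sT) _; rewrite -[leRHS]mulrA ler_pM2l //.
    by apply: IH; rewrite (ltW s0); case/andP: sT.
  move=> /le_trans; apply.
  have -> : L * (D * 2^-1 ^+ k) / (2 * L) * expR (2 * L * t) = D * 2^-1 ^+ k.+1 * expR (2 * L * t).
    by rewrite exprS; field; rewrite gt_eqF.
  by [].
have : `|y t0 - z t0| <= 0.
  apply: (@le0_geometric _ (D * expR (2 * L * t0))) => k.
  by apply: le_trans (step k t0 t0T) _; rewrite mulrAC.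
by rewrite normr_le0 subr_eq0 => /eqP.
Qed.

Section Picard.
Variables (n : nat) (L M : R) (h : R -> 'rV[R]_n -> 'rV[R]_n) (x0 : 'rV[R]_n).
Hypothesis L0 : 0 < L.
Hypothesis hL : forall (s : R) x x', 0 <= s -> `|h s x - h s x'| <= L * `|x - x'|.
Hypothesis hM : forall s : R, 0 <= s -> `|h s x0| <= M.
Hypothesis hmeas : forall y, borel_vec (@Rplus R) y ->
  borel_vec (@Rplus R) (fun s => h s (y s)).

Definition picard (y : R -> 'rV[R]_n) (t : R) : 'rV[R]_n :=
  \row_i (x0 ord0 i + \int[leb]_(s in seg t) h s (y s) ord0 i).

(** Measurable functions at finite distance from [x0] in Bielecki's weighted norm. There Picard's
    operator contracts by 1/2 on the whole half-line, so no short-time solutions have to be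
    glued. *)
Definition tempered (y : R -> 'rV[R]_n) :=
  borel_vec (@Rplus R) y /\
  exists2 K, 0 <= K & forall t : R, 0 <= t -> `|y t - x0| <= K * expR (2 * L * t).

Let M0 : 0 <= M. Proof. exact: le_trans (hM (lexx 0)). Qed.

Let expge1 (t : R) : 0 <= t -> 1 <= expR (2 * L * t).
Proof. by move=> t0; rewrite -expR0 ler_expR !mulr_ge0 // ltW. Qed.

Let L20 : 0 < 2 * L. Proof. by rewrite mulr_gt0. Qed.

Lemma tempered_drift y : tempered y -> exists2 K, 0 <= K & forall (s : R) i, 0 <= s ->
  `|h s (y s) ord0 i| <= K * expR (2 * L * s).
Proof.
move=> [_ [K K0 yK]]; exists (M + L * K); first by rewrite addr_ge0 // mulr_ge0 // ltW.
move=> s i s0; apply: le_trans (coord_le_norm _ _) _.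
rewrite -(subrK (h s x0) (h s (y s))); apply: le_trans (ler_normD _ _) _.
rewrite addrC mulrDl lerD //; first by rewrite (le_trans (hM s0)) // ler_peMr // expge1.
by apply: le_trans (hL _ _ s0) _; rewrite -[leRHS]mulrA ler_pM2l // yK.
Qed.

Lemma tempered_integrable y (t : R) i : tempered y -> 0 <= t ->
  leb.-integrable (seg t) (EFin \o (fun s => h s (y s) ord0 i)).
Proof.
move=> ty t0; have [K K0 hK] := tempered_drift ty.
have [|||||iG bG] := @integral_expR_bound R (fun s => h s (y s) ord0 i) K (2 * L) t => //.
- apply: measurable_funS (hmeas ty.1 i); [exact: measurable_Rplus|exact: segS_Rplus].
- by move=> s /andP[/ltW s0 _]; exact: hK.
Qed.

Lemma picard_tempered y : tempered y -> tempered (picard y).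
Proof.
move=> ty; have [K K0 hK] := tempered_drift ty; split.
  move=> i; rewrite (_ : (fun t => _) =
      (fun t => x0 ord0 i + \int[leb]_(s in seg t) h s (y s) ord0 i)); last first.
    by apply/funext => t; rewrite mxE.
  apply: measurable_funD => //; apply: borel_integral => t t0.
  exact: tempered_integrable.
exists (K / (2 * L)); first by rewrite divr_ge0 // ltW.
move=> t t0; apply: norm_le_coord => [|i].
  by rewrite mulr_ge0 ?expR_ge0 // divr_ge0 // ltW.
rewrite !mxE addrAC subrr add0r.
have [|||||iG bG] := @integral_expR_bound R (fun s => h s (y s) ord0 i) K (2 * L) t => //.
- apply: measurable_funS (hmeas ty.1 i); [exact: measurable_Rplus|exact: segS_Rplus].
- by move=> s /andP[/ltW s0 _]; exact: hK.
Qed.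

Lemma picard_contracts y z d : tempered y -> tempered z -> 0 <= d ->
  (forall t : R, 0 <= t -> `|y t - z t| <= d * expR (2 * L * t)) ->
  forall t : R, 0 <= t -> `|picard y t - picard z t| <= d * 2^-1 * expR (2 * L * t).
Proof.
move=> ty tz d0 yz t t0; apply: norm_le_coord => [|i].
  by rewrite !mulr_ge0 ?expR_ge0.
have iy := tempered_integrable i ty t0; have iz := tempered_integrable i tz t0.
have mt := measurable_seg t.
rewrite !mxE [- (_ + _)]opprD addrACA subrr add0r.
have <- := @RintegralB _ _ _ leb _ _ _ mt iy iz.
have [|||||_] := @integral_expR_bound R
  (fun s => h s (y s) ord0 i - h s (z s) ord0 i) (L * d) (2 * L) t => //.
- by rewrite mulr_ge0 // ltW.
- by apply: measurable_funB; apply: measurable_funS (hmeas _ i);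
    rewrite ?ty.1 ?tz.1 //; try exact: measurable_Rplus; try exact: segS_Rplus;
    [exact: ty.1|exact: tz.1].
- move=> s /andP[/ltW s0 _].
  have := coord_le_norm (h s (y s) - h s (z s)) i; rewrite !mxE => /le_trans; apply.
  by apply: le_trans (hL _ _ s0) _; rewrite -[leRHS]mulrA ler_pM2l // yz.
move=> /le_trans; apply.
rewrite (_ : L * d / (2 * L) = d * 2^-1) //.
by field; rewrite gt_eqF.
Qed.

Let Y k := iter k picard (fun=> x0).

Let Yt k : tempered (Y k).
Proof.
elim: k => [|k IH]; last exact: picard_tempered.
split; first by move=> i; exact: measurable_cst.
by exists 0 => // t _; rewrite subrr normr0 mul0r.
Qed.

Lemma picard_fixpoint : exists2 y, tempered y & forall t : R, 0 <= t -> picard y t = y t.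
Proof.
have [_ [K K0 Y1]] := Yt 1.
have step k (t : R) : 0 <= t -> `|Y k.+1 t - Y k t| <= K * (2^-1) ^+ k * expR (2 * L * t).
  elim: k t => [|k IH] t t0; first by rewrite expr0 mulr1; exact: Y1.
  rewrite exprSr mulrA; apply: (@picard_contracts (Y k.+1) (Y k)) => //.
  by rewrite mulr_ge0 // exprn_ge0.
(* The factor 2 is the sum of the geometric series. *)
have tail k m (t : R) : 0 <= t ->
    `|Y (k + m)%N t - Y k t| <= 2 * K * (2^-1) ^+ k * expR (2 * L * t).
  elim: m k t => [|m IH] k t t0.
    by rewrite addn0 subrr normr0 !mulr_ge0 ?expR_ge0 // exprn_ge0.
  rewrite addnS -addSn -(subrK (Y k.+1 t) (Y (k.+1 + m)%N t)) -addrA.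
  apply: le_trans (ler_normD _ _) _.
  apply: le_trans (lerD (IH k.+1 t t0) (step k t t0)) _.
  by rewrite exprS -mulrDl ler_pM2r ?expR_gt0 // le_eqVlt; apply/orP; left; apply/eqP; field.
have tailc k m (t : R) i : 0 <= t ->
    `|Y (k + m)%N t ord0 i - Y k t ord0 i| <= 2 * K * (2^-1) ^+ k * expR (2 * L * t).
  move=> t0; apply: le_trans (tail k m t t0).
  by have := coord_le_norm (Y (k + m)%N t - Y k t) i; rewrite !mxE.
have cvgY (t : R) i : 0 <= t -> cvgn (fun k => Y k t ord0 i).
  move=> t0; apply/cauchy_cvgP; apply: cauchy_exP => e e0.
  have [k ke] := geometric_small (2 * K * expR (2 * L * t)) e0.
  exists (Y k t ord0 i); exists k => // m /= km.
  rewrite /ball /= distrC -(subnKC km).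
  by apply: le_lt_trans (tailc _ _ _ _ t0) _; rewrite mulrAC.
(* Limits by time and coordinate are enough: measurability passes to pointwise limits, and the
   weighted estimate on the tails survives the limit. *)
pose y (t : R) : 'rV[R]_n := \row_i limn (fun k => Y k t ord0 i).
have yY k (t : R) : 0 <= t -> `|y t - Y k t| <= 2 * K * (2^-1) ^+ k * expR (2 * L * t).
  move=> t0; apply: norm_le_coord => [|i].
    by rewrite !mulr_ge0 ?expR_ge0 // exprn_ge0.
  rewrite !mxE; apply/ler_addgt0Pr => e e0.
  have /cvgrPdist_lt/(_ e e0)[N _ HN] := cvgY t i t0.
  have := HN (k + N)%N (leq_addl _ _) => /ltW h1.
  rewrite -(subrK (Y (k + N)%N t ord0 i) (limn _)) -addrA addrC.
  apply: le_trans (ler_normD _ _) _; rewrite lerD //.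
  exact: tailc.
have ty : tempered y.
  split.
    move=> i; apply: (measurable_fun_cvg (h := fun k t => Y k t ord0 i)).
      by move=> k; exact: (Yt k).1.
    by move=> t t0; rewrite mxE; exact: cvgY.
  exists (2 * K); first by rewrite mulr_ge0.
  by move=> t t0; have := yY 0%N t t0; rewrite expr0 mulr1.
exists y => // t t0; apply/eqP; rewrite -subr_eq0 -normr_le0.
apply: (@le0_geometric _ (2 * K * expR (2 * L * t))) => k.
rewrite -(subrK (Y k.+1 t) (picard y t)) -addrA; apply: le_trans (ler_normD _ _) _.
have d0 : 0 <= 2 * K * 2^-1 ^+ k by rewrite !mulr_ge0 // exprn_ge0.
have h1 := picard_contracts ty (Yt k) d0 (yY k) t0.
have h2 := yY k.+1 t t0; rewrite distrC in h2.
apply: le_trans (lerD h1 h2) _.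
by rewrite exprS le_eqVlt; apply/orP; left; apply/eqP; field.
Qed.

Lemma caratheodory_exists : exists2 y, borel_vec (@Rplus R) y & forall T : R, sol_on T h x0 y.
Proof.
have [y ty py] := picard_fixpoint; exists y; first exact: ty.1.
move=> T t /andP[t0 _] i; split; first exact: tempered_integrable.
by rewrite -py // mxE addrAC subrr add0r.
Qed.

End Picard.

End Caratheodory.

(** * Time shifts of integrals, solutions and weights *)

Section ShiftedFunctions.
Variable R : realType.
Local Notation leb := (@lebesgue_measure R).
Local Notation seg t := [set s : R | (0 <= s <= t)%R].

Lemma measurable_shift (F : R -> R) (h : R) : 0 <= h ->
  measurable_fun (@Rplus R) F -> measurable_fun (@Rplus R) (fun t => F (t + h)).
Proof.
move=> h0 mF; have := @measurable_fun_affine R _ _ 1 h _ _ (@measurable_Rplus R) mF.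
rewrite (_ : (fun t => F (1 * t + h)) = (fun t => F (t + h))); last first.
  by apply/funext => t; rewrite mul1r.
apply: measurable_funS.
  by rewrite -[X in measurable X]setTI; apply: (measurable_affine 1 h) => //; exact: measurable_Rplus.
by move=> t; rewrite /Rplus /= mul1r => t0; rewrite addr_ge0.
Qed.

Lemma ge0_integral_split (F : R -> R) (h : R) : 0 <= h ->
  measurable_fun (@Rplus R) F -> (forall t, 0 <= t -> 0 <= F t) ->
  (\int[leb]_(t in @Rplus R) (F t)%:E =
   \int[leb]_(t in seg h) (F t)%:E + \int[leb]_(t in @Rplus R) (F (t + h))%:E)%E.
Proof.
move=> h0 mF F0.
have E : @Rplus R = seg h `|` `]h, +oo[%classic.
  apply/seteqP; split=> t; rewrite /Rplus /= in_itv /= andbT.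
    by move=> t0; case: (leP t h); [left|right] => //; rewrite t0.
  by case=> [/andP[]//|/ltW]; exact: le_trans.
have S : `[h, +oo[%classic `<=` @Rplus R.
  by move=> t; rewrite /= in_itv /= andbT; exact: le_trans.
have S' : `]h, +oo[%classic `<=` @Rplus R.
  by move=> t; rewrite /= in_itv /= andbT => /ltW; exact: le_trans.
rewrite [in LHS]E ge0_integral_setU //; first last.
- apply/disj_setPS => t [] /= /andP[_ th]; rewrite in_itv /= andbT ltNge.
  by rewrite th.
- by rewrite -E => t t0; rewrite lee_fin F0.
- by rewrite -E; exact/measurable_EFinP.
- exact: measurable_seg.
congr (_ + _)%E; rewrite integral_itv_obnd_cbnd; last first.
  by apply/measurable_EFinP; apply: measurable_funS mF => //; exact: measurable_Rplus.
rewrite (integral_shift h); first last.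
- by apply/measurable_EFinP; apply: measurable_funS mF => //; exact: measurable_Rplus.
- exact: measurable_itv.
rewrite (_ : (fun t => t + h) @^-1` _ = @Rplus R) //.
by apply/seteqP; split=> t /=; rewrite in_itv /= andbT lerDr.
Qed.

Lemma sol_on_shift n (H : R -> 'rV[R]_n -> 'rV[R]_n) x0 y (h T : R) : 0 <= h ->
  sol_on (T + h) H x0 y ->
  sol_on T (fun s => H (s + h)) (y h) (fun t => y (t + h)).
Proof.
move=> h0 S t /andP[t0 tT] i.
pose F s := H s (y s) ord0 i.
have thT : 0 <= t + h <= T + h by rewrite addr_ge0 //= lerD2r.
have hT : 0 <= h <= T + h by rewrite h0 /= lerDr (le_trans t0).
have [iF eF] := S _ thT i; have [iF' eF'] := S _ hT i.
have D : (fun s => s + h) @^-1` `[h, t + h]%classic = seg t.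
  by apply/seteqP; split=> s /=; rewrite in_itv /= lerDr lerD2r.
have sub : `[h, t + h]%classic `<=` seg (t + h).
  by move=> s /=; rewrite in_itv /= => /andP[/(le_trans h0) -> ->].
have iFh : leb.-integrable `[h, t + h]%classic (EFin \o F).
  by apply: integrableS iF => //; exact: measurable_seg.
have /integrableP[mFh fFh] := iFh.
split.
  apply/integrableP; split.
    apply/measurable_EFinP.
    have /measurable_EFinP mF' := mFh.
    have := @measurable_fun_affine R _ _ 1 h _ _ (measurable_itv `[h, t + h]) mF'.
    rewrite (_ : (fun t => F (1 * t + h)) = (fun t => F (t + h))); last first.
      by apply/funext => s; rewrite mul1r.
    by rewrite (_ : (fun s => 1 * s + h) = (fun s => s + h)) ?D //;
      apply/funext => s; rewrite mul1r.
  move: fFh; rewrite (integral_shift h) ?D //; apply: measurableT_comp => //.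
have -> : \int[leb]_(s in seg t) H (s + h) (y (s + h)) ord0 i = \int[leb]_(s in `[h, t + h]) F s.
  by rewrite /Rintegral [in RHS](integral_shift h) ?D.
rewrite -Rintegral_itv_obnd_cbnd; last first.
  by apply: integrableS iFh => //; exact: subset_itv_oc_cc.
rewrite segE in iF eF; rewrite segE in eF'.
rewrite -(@Rintegral_itvB R F (BLeft 0) (BRight (t + h)) h) //.
- by rewrite -/F in eF eF'; rewrite eF eF' opprB addrA subrK.
- by rewrite bnd_simp lerDr.
Qed.

(** The mass is neither normalised nor positive: tails and boxes carry arbitrary mass, and the zero
    weight ends every step function. *)
Definition weight (r : R -> R) : Prop :=
  (forall t : R, 0 <= t -> 0 <= r t) /\ measurable_fun (@Rplus R) r /\
  (\int[leb]_(t in @Rplus R) (r t)%:E < +oo)%E.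

Lemma weight_shift r (h : R) : 0 <= h -> weight r -> weight (fun t => r (t + h)).
Proof.
move=> h0 [r0 [mr ir]]; split=> [t t0|]; first by apply: r0; rewrite addr_ge0.
split; first exact: measurable_shift.
apply: le_lt_trans ir; rewrite (ge0_integral_split h0 mr) // leeDr //.
by apply: integral_ge0 => t /andP[t0 _]; rewrite lee_fin r0.
Qed.

Lemma weight_mul r (c : R) : 0 < c -> weight r -> weight (fun t => c * r t).
Proof.
move=> c0 [r0 [mr ir]]; split=> [t t0|]; first by rewrite mulr_ge0 ?r0 // ltW.
split; first by apply: measurable_funM.
under eq_integral do rewrite EFinM.
rewrite ge0_integralZl_EFin //.
- by rewrite lte_mul_pinfty // ?lee_fin ?ltW.
- exact: measurable_Rplus.
- by apply/measurable_EFinP.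
- exact: ltW.
Qed.

End ShiftedFunctions.

(** * Trajectories, payoffs and values *)

Section ControlledSystem.
Variable R : realType.
Local Notation leb := (@lebesgue_measure R).
Local Notation seg t := [set s : R | (0 <= s <= t)%R].

Lemma borel_vec_shift k (a : R -> 'rV[R]_k) (h : R) : 0 <= h ->
  borel_vec (@Rplus R) a -> borel_vec (@Rplus R) (fun t => a (t + h)).
Proof. by move=> h0 ma i; exact: (measurable_shift h0 (ma i)). Qed.

Lemma control_shift k (K : set 'rV[R]_k) a (h : R) : 0 <= h -> control K a ->
  control K (fun t => a (t + h)).
Proof.
move=> h0 [Ka [ma [M aM]]]; split=> [t t0|]; first by apply: Ka; rewrite addr_ge0.
split; first exact: borel_vec_shift.
by exists M => t t0; apply: aM; rewrite addr_ge0.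
Qed.

Definition paste T (h : R) (a a' : R -> T) : R -> T :=
  fun t => if t <= h then a t else a' (t - h).

Lemma control_paste k (K : set 'rV[R]_k) a a' (h : R) : 0 <= h ->
  control K a -> control K a' -> control K (paste h a a').
Proof.
move=> h0 [Ka [ma [M aM]]] [Ka' [ma' [M' aM']]]; split=> [t t0|].
  rewrite /paste; case: leP => th; first exact: Ka.
  by apply: Ka'; rewrite subr_ge0 ltW.
split.
  move=> i; rewrite (_ : (fun t => _) = (fun t => if t <= h then a t ord0 i else a' (t - h) ord0 i)).
    have E : @Rplus R = seg h `|` `]h, +oo[%classic.
      apply/seteqP; split=> t; rewrite /Rplus /= in_itv /= andbT.
        by move=> t0; case: (leP t h); [left|right] => //; rewrite t0.
      by case=> [/andP[]//|/ltW]; exact: le_trans.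
    rewrite E; apply/measurable_funU => //; first exact: measurable_seg.
    split.
      apply: (eq_measurable_fun (fun t => a t ord0 i)).
        by move=> t /set_mem /= /andP[_ ->].
      by apply: measurable_funS (ma i); [exact: measurable_Rplus|exact: segS_Rplus].
    apply: (eq_measurable_fun (fun t : R => a' (t - h) ord0 i)).
      by move=> t /set_mem /=; rewrite in_itv /= andbT ltNge => /negbTE ->.
    have := @measurable_fun_affine R _ _ 1 (- h) _ _ (@measurable_Rplus R) (ma' i).
    rewrite (_ : (fun t => a' (1 * t - h) ord0 i) = (fun t => a' (t - h) ord0 i)); last first.
      by apply/funext => t; rewrite mul1r.
    apply: measurable_funS.
      by rewrite -[X in measurable X]setTI; apply: (measurable_affine 1 (- h)) => //; exact: measurable_Rplus.
    by move=> t; rewrite /Rplus /= in_itv /= andbT mul1r subr_ge0 => /ltW.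
  by apply/funext => t; rewrite /paste; case: leP.
exists (Num.max M M') => t t0; rewrite /paste le_max; case: (leP t h) => th.
  by rewrite aM.
by rewrite aM' ?orbT // subr_ge0 ltW.
Qed.

Variables (n p q : nat) (A : set 'rV[R]_p) (B : set 'rV[R]_q).
Variables (f : 'rV[R]_n -> 'rV[R]_p -> 'rV[R]_q -> 'rV[R]_n)
          (g : 'rV[R]_n -> 'rV[R]_p -> 'rV[R]_q -> R) (L : R).
Hypothesis cA : compact A.
Hypothesis cB : compact B.
Hypothesis cf : {within [set z : 'rV[R]_n * 'rV[R]_p * 'rV[R]_q | A z.1.2 /\ B z.2],
     continuous (fun z => f z.1.1 z.1.2 z.2)}.
Hypothesis cg : {within [set z : 'rV[R]_n * 'rV[R]_p * 'rV[R]_q | A z.1.2 /\ B z.2],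
     continuous (fun z => g z.1.1 z.1.2 z.2)}.
Hypothesis g01 : forall x a b, A a -> B b -> 0 <= g x a b <= 1.
Hypothesis L0 : 0 < L.
Hypothesis fL : forall x y a b, A a -> B b -> `|f x a b - f y a b| <= L * `|x - y|.

(** By compactness of [{x0} x A x B]; Picard's iteration needs this bound uniformly in time. *)
Lemma drift_bounded x0 : exists M : R, forall a b, A a -> B b -> `|f x0 a b| <= M.
Proof.
pose K := ([set x0] `*` A) `*` B.
have cK : compact K.
  by apply: compact_setX => //; apply: compact_setX => //; exact: compact_set1.
have sub : K `<=` [set z : 'rV[R]_n * 'rV[R]_p * 'rV[R]_q | A z.1.2 /\ B z.2].
  by move=> [[x a] b] [[_ Aa] Bb].
have cf' := continuous_subspaceW sub cf.
have /compact_bounded [M [_ HM]] := continuous_compact cf' cK.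
exists (M + 1) => a b Aa Bb; apply: (HM (M + 1)); first by rewrite ltrDl.
by exists (x0, a, b).
Qed.

Lemma borel_drift (a : R -> 'rV[R]_p) (b : R -> 'rV[R]_q) y :
  control A a -> control B b -> borel_vec (@Rplus R) y ->
  borel_vec (@Rplus R) (fun s => f (y s) (a s) (b s)).
Proof.
move=> [Aa [ma _]] [Bb [mb _]] my i.
apply: (measurable_fun_comp_continuous (A := A) (B := B)
  (F := fun x a b => f x a b ord0 i)) => //.
apply: (@within_continuous_comp _ _ _ _ _ (fun x : 'rV[R]_n => x ord0 i) _ cf).
by move=> x _; exact: coord_continuous.
Qed.

Lemma is_solutionP x0 a b y : is_solution f x0 a b y <->
  forall T, sol_on T (fun s x => f x (a s) (b s)) x0 y.
Proof.
split=> [S T t /andP[t0 _] i|S t t0 i].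
  by have [i1 e1] := S t t0 i; split=> //; rewrite /Rintegral e1.
have tt : 0 <= t <= t by rewrite t0 lexx.
have [i1 e1] := S t t tt i; split=> //.
rewrite -e1 fineK //.
by have := @integrable_fin_num _ _ _ leb _ (measurable_seg t) _ i1.
Qed.

(** [traj] is picked by [epsilon]; only the existence of some solution makes it one. *)
Lemma traj_sol x0 a b : control A a -> control B b ->
  forall T, sol_on T (fun s x => f x (a s) (b s)) x0 (traj f x0 a b).
Proof.
move=> Ca Cb; apply/is_solutionP; rewrite /traj; apply: epsilon_spec.
have [M fM] := drift_bounded x0.
have [|||y _ Sy] := @caratheodory_exists R n L M (fun s x => f x (a s) (b s)) x0 L0.
- by move=> s x x' s0; apply: fL; [exact: Ca.1|exact: Cb.1].
- by move=> s s0; apply: fM; [exact: Ca.1|exact: Cb.1].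
- by move=> y my; exact: borel_drift.
by exists y; apply/is_solutionP.
Qed.

Lemma traj_unique x0 a b a' b' T : control A a -> control B b ->
  control A a' -> control B b' ->
  (forall s, 0 < s <= T -> a s = a' s /\ b s = b' s) ->
  forall t, 0 <= t <= T -> traj f x0 a b t = traj f x0 a' b' t.
Proof.
move=> Ca Cb Ca' Cb' E.
apply: (@sol_on_unique R n L T (fun s x => f x (a s) (b s)) (fun s x => f x (a' s) (b' s)) x0) => //.
- by move=> s x x' /andP[/ltW s0 _]; apply: fL; [exact: Ca.1|exact: Cb.1].
- by move=> s x /E[-> ->].
- exact: traj_sol.
- exact: traj_sol.
Qed.

Lemma traj_shift x0 a b (h t : R) : control A a -> control B b -> 0 <= h -> 0 <= t ->
  traj f x0 a b (t + h) =
  traj f (traj f x0 a b h) (fun s => a (s + h)) (fun s => b (s + h)) t.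
Proof.
move=> Ca Cb h0 t0.
have S := sol_on_shift h0 (@traj_sol x0 _ _ Ca Cb (t + h)).
have tt : 0 <= t <= t by rewrite t0 lexx.
apply: (@sol_on_unique R n L t _ _ _ _ _ L0 _ _ S
  (@traj_sol _ _ _ (control_shift h0 Ca) (control_shift h0 Cb) t)) tt => //.
move=> s x x' /andP[/ltW s0 _]; apply: fL; [apply: Ca.1|apply: Cb.1]; exact: addr_ge0.
Qed.

Lemma borel_traj x0 a b : control A a -> control B b ->
  borel_vec (@Rplus R) (traj f x0 a b).
Proof.
move=> Ca Cb i.
pose F s := f (traj f x0 a b s) (a s) (b s) ord0 i.
have S (t : R) : 0 <= t -> leb.-integrable (seg t) (EFin \o F) /\
    \int[leb]_(s in seg t) F s = traj f x0 a b t ord0 i - x0 ord0 i.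
  by move=> t0; apply: (@traj_sol x0 _ _ Ca Cb t); rewrite t0 lexx.
apply: (eq_measurable_fun (fun t => x0 ord0 i + \int[leb]_(s in seg t) F s)).
  by move=> t /set_mem /S[_ ->]; rewrite addrC subrK.
by apply: measurable_funD => //; apply: borel_integral => t /S[].
Qed.

Lemma borel_running x0 a b : control A a -> control B b ->
  measurable_fun (@Rplus R) (fun t => g (traj f x0 a b t) (a t) (b t)).
Proof.
move=> Ca Cb; apply: (measurable_fun_comp_continuous (A := A) (B := B)) => //.
- exact: borel_traj.
- exact: Ca.2.1.
- exact: Cb.2.1.
- by move=> t; exact: Ca.1.
- by move=> t; exact: Cb.1.
Qed.

Lemma payoff_measurable r x a b : weight r -> control A a -> control B b ->
  measurable_fun (@Rplus R) (fun t => r t * g (traj f x a b t) (a t) (b t)).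
Proof. by move=> [_ [mr _]] Ca Cb; apply: measurable_funM => //; exact: borel_running. Qed.

Lemma running01 x a b (t : R) : control A a -> control B b -> 0 <= t ->
  0 <= g (traj f x a b t) (a t) (b t) <= 1.
Proof. by move=> Ca Cb t0; apply: g01; [exact: Ca.1|exact: Cb.1]. Qed.

Lemma integrand_ge0 r x a b (t : R) : weight r -> control A a -> control B b -> 0 <= t ->
  0 <= r t * g (traj f x a b t) (a t) (b t).
Proof.
by move=> [r0 _] Ca Cb t0; rewrite mulr_ge0 ?r0 //; case/andP: (running01 x Ca Cb t0).
Qed.

Lemma payoff_ge0 r x a b : weight r -> control A a -> control B b ->
  (0 <= payoff f g r x a b)%E.
Proof.
by move=> wr Ca Cb; apply: integral_ge0 => t t0; rewrite lee_fin integrand_ge0.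
Qed.

Lemma payoff_le_mass r x a b : weight r -> control A a -> control B b ->
  (payoff f g r x a b <= \int[leb]_(t in @Rplus R) (r t)%:E)%E.
Proof.
move=> wr Ca Cb; apply: ge0_le_integral.
- exact: measurable_Rplus.
- by move=> t t0; rewrite lee_fin integrand_ge0.
- by apply/measurable_EFinP; exact: payoff_measurable.
- by apply/measurable_EFinP; case: wr => _ [].
- move=> t t0; rewrite lee_fin ler_piMr //; first exact: wr.1.
  by case/andP: (running01 x Ca Cb t0).
Qed.

Lemma payoff_split r x a b (h : R) : 0 <= h -> weight r -> control A a -> control B b ->
  (payoff f g r x a b =
   \int[leb]_(t in seg h) (r t * g (traj f x a b t) (a t) (b t))%:E +
   payoff f g (fun t => r (t + h)%R) (traj f x a b h)
     (fun t => a (t + h)%R) (fun t => b (t + h)%R))%E.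
Proof.
move=> h0 wr Ca Cb.
rewrite /payoff (ge0_integral_split h0 (payoff_measurable x wr Ca Cb)); last first.
  by move=> t t0; exact: integrand_ge0.
by congr (_ + _)%E; apply: eq_integral => t /set_mem t0; rewrite traj_shift.
Qed.

(** Meant for a pasted control shifted back by the switching time: at time 0 it still shows the old
    control, at positive times the new one. *)
Lemma payoff_eq_pos r x a b a' b' : weight r -> control A a -> control B b ->
  control A a' -> control B b' ->
  (forall t : R, 0 < t -> a t = a' t /\ b t = b' t) ->
  payoff f g r x a b = payoff f g r x a' b'.
Proof.
move=> wr Ca Cb Ca' Cb' E; rewrite /payoff RplusE.
have S : `]0, +oo[%classic `<=` @Rplus R.
  by move=> t; rewrite /= in_itv /= andbT => /ltW.
rewrite -!integral_itv_obnd_cbnd.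
- apply: eq_integral => t /set_mem /=; rewrite in_itv /= andbT => t0.
  have [-> ->] := E t t0.
  rewrite (@traj_unique x a b a' b' t) ?lexx ?ltW //.
  by move=> s /andP[s0 _]; exact: E.
- apply/measurable_EFinP; apply: measurable_funS (payoff_measurable x wr Ca' Cb') => //.
  exact: measurable_Rplus.
- apply/measurable_EFinP; apply: measurable_funS (payoff_measurable x wr Ca Cb) => //.
  exact: measurable_Rplus.
Qed.

Lemma control_cst k (K : set 'rV[R]_k) c : K c -> control K (fun=> c).
Proof.
move=> Kc; split=> //; split; first by move=> i; exact: measurable_cst.
by exists `|c|.
Qed.

(** * Finiteness, homogeneity and Lipschitz continuity of the value *)

Hypothesis A0 : A !=set0.
Hypothesis B0 : B !=set0.
Local Notation V := (value A B f g).

(** Excludes the default of [fine] in [value]: payoffs lie between 0 and the mass, constant controls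
    exist for both players, and a constant strategy enters the infimum. *)
Lemma value_fin r x : weight r ->
  ereal_inf [set ereal_sup [set payoff f g r x (alpha b) b | b in control B]
            | alpha in quasistrategy A B] \is a fin_num.
Proof.
move=> wr; have [a0 Aa0] := A0; have [b0 Bb0] := B0.
have Qa0 : quasistrategy A B (fun=> (fun=> a0)) by split=> // b _; exact: control_cst.
rewrite ge0_fin_numE; last first.
  apply: le_ereal_inf_tmp => _ [al [Qa _] <-].
  have Cb := control_cst Bb0.
  apply: le_trans (payoff_ge0 x wr (Qa _ Cb) Cb) _.
  by apply: ereal_sup_ubound; exists (fun=> b0).
have [_ [_ ir]] := wr; apply: le_lt_trans ir.
apply: le_trans (ereal_inf_lbound _) _.
  by exists (fun=> (fun=> a0)).
apply: ge_ereal_sup => _ [b Cb <-]; apply: payoff_le_mass => //.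
exact: control_cst.
Qed.

Lemma value_approx r x (e : R) : weight r -> 0 < e ->
  exists2 al, quasistrategy A B al &
    forall b, control B b -> (payoff f g r x (al b) b <= (V r x + e)%:E)%E.
Proof.
move=> wr e0; have [_ [al Qa <-] lt] := lb_ereal_inf_adherent e0 (value_fin x wr).
exists al => // b Cb; rewrite EFinD /value fineK; last exact: value_fin.
apply: le_trans (ltW lt); apply: ereal_sup_ubound.
by exists b.
Qed.

Lemma value_le r x al c : weight r -> quasistrategy A B al ->
  (forall b, control B b -> (payoff f g r x (al b) b <= c%:E)%E) -> V r x <= c.
Proof.
move=> wr Qa H; rewrite -lee_fin /value fineK; last exact: value_fin.
apply: le_trans (ereal_inf_lbound _) _; first by exists al.
by apply: ge_ereal_sup => _ [b Cb <-]; exact: H.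
Qed.

Lemma value_reply r x al (e : R) : weight r -> quasistrategy A B al -> 0 < e ->
  exists2 b, control B b & ((V r x - e)%:E <= payoff f g r x (al b) b)%E.
Proof.
move=> wr Qa e0; apply: contrapT => H.
have : V r x <= V r x - e.
  apply: (value_le wr Qa) => b Cb; rewrite leNgt; apply/negP => lt.
  by apply: H; exists b => //; exact: ltW.
by rewrite lerBrDr gerDl leNgt e0.
Qed.

Lemma value_ge0 r x : weight r -> 0 <= V r x.
Proof.
move=> wr; apply/ler_addgt0Pr => e e0; have [al Qa H] := value_approx x wr e0.
have [b0 /control_cst Cb] := B0.
by rewrite -lee_fin (le_trans _ (H _ Cb)) // payoff_ge0 //; exact: Qa.1.
Qed.

Lemma value_eq r r' : (forall t : R, 0 <= t -> r t = r' t) -> V r = V r'.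
Proof.
move=> E; rewrite /value.
suff -> : payoff f g r = payoff f g r' by [].
apply/funext => x; apply/funext => a; apply/funext => b.
by apply: eq_integral => t /set_mem t0; rewrite E.
Qed.

Lemma value_homogeneous_le r x (c : R) : 0 < c -> weight r -> weight (fun t => c * r t) ->
  V (fun t => c * r t) x <= c * V r x.
Proof.
move=> c0 wr wcr; apply/ler_addgt0Pr => e e0.
have [al Qa H] := value_approx x wr (divr_gt0 e0 c0).
apply: (value_le wcr Qa) => b Cb.
have -> : payoff f g (fun t => c * r t) x (al b) b = (c%:E * payoff f g r x (al b) b)%E.
  rewrite /payoff -ge0_integralZl_EFin //.
  - by apply: eq_integral => t _; rewrite -EFinM mulrA.
  - exact: measurable_Rplus.
  - by move=> t t0; rewrite lee_fin integrand_ge0 //; exact: Qa.1.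
  - by apply/measurable_EFinP; apply: payoff_measurable => //; exact: Qa.1.
  - exact: ltW.
apply: le_trans (lee_wpmul2l _ (H b Cb)) _; first by rewrite lee_fin ltW.
by rewrite -EFinM lee_fin mulrDr (mulrC c (e / c)) divfK // gt_eqF.
Qed.

Lemma value_homogeneous r x (c : R) : 0 < c -> weight r ->
  V (fun t => c * r t) x = c * V r x.
Proof.
move=> c0 wr; have wcr := weight_mul c0 wr.
apply/eqP; rewrite eq_le value_homogeneous_le //=.
(* The converse is the same inequality for the factor [c^-1] and the weight [c * r]. *)
rewrite -ler_pdivlMl //.
have E : (fun t => c^-1 * (c * r t)) = r.
  by apply/funext => t; rewrite mulrA mulVf ?mul1r // gt_eqF.
have := @value_homogeneous_le (fun t => c * r t) x c^-1; rewrite E.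
by apply => //; rewrite invr_gt0.
Qed.

Lemma integral_running_le (D : set R) r r' x a b (I : R) :
  measurable D -> D `<=` @Rplus R ->
  weight r -> weight r' -> control A a -> control B b ->
  (\int[leb]_(t in D) `|r t - r' t|%:E <= I%:E)%E ->
  (\int[leb]_(t in D) (r t * g (traj f x a b t) (a t) (b t))%:E <=
   \int[leb]_(t in D) (r' t * g (traj f x a b t) (a t) (b t))%:E + I%:E)%E.
Proof.
move=> mD DR wr wr' Ca Cb HI; apply: le_trans (leeD2l _ HI).
have mS F : measurable_fun (@Rplus R) F -> measurable_fun D (EFin \o F).
  by move=> mF; apply/measurable_EFinP; apply: measurable_funS mF => //; exact: measurable_Rplus.
have mabs : measurable_fun (@Rplus R) (fun t => `|r t - r' t|).
  by apply: measurableT_comp => //; apply: measurable_funB; [case: wr => _ []|case: wr' => _ []].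
rewrite -ge0_integralD //.
- apply: ge0_le_integral => //.
  + by move=> t /DR t0; rewrite lee_fin integrand_ge0.
  + by apply: mS; exact: payoff_measurable.
  + apply: emeasurable_funD; apply: mS => //; exact: payoff_measurable.
  + move=> t /DR t0; rewrite -EFinD lee_fin.
    have /andP[g0 g1] := running01 x Ca Cb t0.
    rewrite -lerBlDl -mulrBl; apply: le_trans (ler_norm _) _.
    by rewrite normrM (ger0_norm g0) ler_piMr.
- by move=> t /DR t0; rewrite lee_fin integrand_ge0.
- by apply: mS; exact: payoff_measurable.
- exact: mS.
Qed.

(** A strategy nearly optimal for [r'] is used for [r]; every payoff changes by at most [I], since
    the running cost lies in [[0, 1]]. *)
Lemma value_lipschitz r r' x (I : R) : weight r -> weight r' ->
  (\int[leb]_(t in @Rplus R) `|r t - r' t|%:E <= I%:E)%E -> V r x <= V r' x + I.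
Proof.
move=> wr wr' HI; apply/ler_addgt0Pr => e e0.
have [al Qa H] := value_approx x wr' e0.
apply: (value_le wr Qa) => b Cb.
apply: le_trans (integral_running_le x (@measurable_Rplus R) (fun _ H => H)
  wr wr' (Qa.1 _ Cb) Cb HI) _.
by apply: le_trans (leeD2r _ (H b Cb)) _; rewrite -EFinD lee_fin addrAC.
Qed.

(** * Switching strategies at a fixed time *)

Variable Om : set 'rV[R]_n.
Hypothesis inv : forall x0 a b (t : R), Om x0 -> control A a -> control B b -> 0 <= t ->
  Om (traj f x0 a b t).

(* Up to time [h] play [al'], then switch to [sig z], [z] the state reached; a quasistrategy
   constrains replies only on segments [[0, t]] with [0 < t], so [al'] has to be kept at
   time [h] itself. *)
Lemma quasistrategy_switch x (h : R) al' (sig : 'rV[R]_n -> (R -> 'rV[R]_q) -> R -> 'rV[R]_p) :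
  Om x -> 0 < h -> quasistrategy A B al' ->
  (forall z, Om z -> quasistrategy A B (sig z)) ->
  quasistrategy A B (fun b =>
    paste h (al' b) (sig (traj f x (al' b) b h) (fun t => b (t + h)))).
Proof.
move=> Ox h0 [Ca' Na'] Hsig; have h0' := ltW h0.
have Oz b : control B b -> Om (traj f x (al' b) b h).
  by move=> Cb; apply: inv => //; exact: Ca'.
split=> [b Cb|b b' t Cb Cb' t0 E s /andP[s0 st]].
  apply: control_paste => //; first exact: Ca'.
  by apply: (Hsig _ (Oz _ Cb)).1; exact: control_shift.
rewrite /paste; case: (leP s h) => sh.
  by apply: (Na' b b' t) => //; rewrite s0.
have ht : h < t by exact: lt_le_trans st.
have Eh u : 0 <= u <= h -> b u = b' u.
  by move=> /andP[u0 uh]; apply: E; rewrite u0 (le_trans uh) // ltW.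
have <- : traj f x (al' b) b h = traj f x (al' b') b' h.
  apply: (@traj_unique x _ _ _ _ h) => //; try exact: Ca'; last by rewrite h0' lexx.
  move=> u /andP[/ltW u0 uh]; have u0h : 0 <= u <= h by rewrite u0.
  by split; [apply: (Na' b b' h)|apply: Eh].
apply: ((Hsig _ (Oz _ Cb)).2 _ _ (t - h)).
- exact: control_shift.
- exact: control_shift.
- by rewrite subr_gt0.
- by move=> u /andP[u0 ut]; apply: E; rewrite addr_ge0 //= -lerBrDr.
- by rewrite subr_ge0 (ltW sh) lerD2r.
Qed.

(** With the opponent's history [b] up to [h] frozen, [al] becomes a strategy of the remaining game,
    to which a near-best reply of the opponent exists. *)
Lemma quasistrategy_continuation (h : R) al b : 0 < h -> quasistrategy A B al -> control B b ->
  quasistrategy A B (fun be t => al (paste h b be) (t + h)).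
Proof.
move=> h0 [Ca Na] Cb; have h0' := ltW h0.
split=> [be Cbe|be be' t Cbe Cbe' t0 E s /andP[s0 st]].
  by apply: control_shift => //; apply: Ca; exact: control_paste.
apply: (Na _ _ (t + h)).
- exact: control_paste.
- exact: control_paste.
- by rewrite addr_gt0.
- move=> u /andP[u0 ut]; rewrite /paste; case: (leP u h) => // hu.
  by apply: E; rewrite subr_ge0 (ltW hu) lerBlDr.
- by rewrite addr_ge0 //= lerD2r.
Qed.

(** Both halves of the dynamic programming principle at once. The first player follows a strategy
    nearly optimal for [r'] up to [h], then one nearly optimal for the shifted [r]. After [h] the
    former strategy could not have beaten the value of the shifted [r']: the opponent's near-best
    reply shows this. *)
Lemma value_compare_step r r' x (h I D : R) : weight r -> weight r' -> Om x -> 0 < h ->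
  (\int[leb]_(t in seg h) `|r t - r' t|%:E <= I%:E)%E ->
  (forall z, Om z -> V (fun t => r (t + h)) z <= V (fun t => r' (t + h)) z + D) ->
  V r x <= V r' x + I + D.
Proof.
move=> wr wr' Ox h0 HI HD; have h0' := ltW h0; apply/ler_addgt0Pr => e e0.
have e30 : 0 < e / 3 by rewrite divr_gt0.
have wrh := weight_shift h0' wr; have wrh' := weight_shift h0' wr'.
have [al' Qa' Ha'] := value_approx x wr' e30.
(* One nearly optimal strategy for each possible state; the state actually reached selects among
   them. *)
have /choice[sig Hsig] : forall z, exists al, Om z -> quasistrategy A B al /\
    forall b, control B b ->
      (payoff f g (fun t => r (t + h)%R) z (al b) b <=
       (V (fun t => r (t + h)) z + e / 3)%:E)%E.
  by move=> z; have [al Qa Ha] := value_approx z wrh e30; exists al.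
have Qal := quasistrategy_switch Ox h0 Qa' (fun z Oz => (Hsig z Oz).1).
apply: (value_le wr Qal) => b Cb /=.
set z := traj f x (al' b) b h.
have Ca' : control A (al' b) by exact: Qa'.1.
have Cbh := control_shift h0' Cb.
have Oz : Om z by exact: inv.
have Cs : control A (sig z (fun t => b (t + h))) by exact: (Hsig z Oz).1.1.
set a := paste h (al' b) _.
have Ca : control A a by exact: control_paste.
(* After the history [b], the reply [be] makes the continuation of [al'] cost at least the value of
   the shifted [r'] less [e / 3]. *)
have [be Cbe Hbe] := value_reply z wrh' (quasistrategy_continuation h0 Qa' Cb) e30.
set b2 := paste h b be in Hbe; have Cb2 : control B b2 by exact: control_paste.
have Ca2 : control A (al' b2) by exact: Qa'.1.
have b2b (u : R) : u <= h -> b2 u = b u by rewrite /b2 /paste => ->.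
have a2a (u : R) : 0 <= u <= h -> al' b2 u = al' b u.
  by apply: (Qa'.2 _ _ h) => // s /andP[_ sh]; exact: b2b.
have aa (u : R) : u <= h -> a u = al' b u by rewrite /a /paste => ->.
have t1 (u : R) : 0 <= u <= h -> traj f x a b u = traj f x (al' b) b u.
  by apply: traj_unique => // s /andP[_ sh]; rewrite aa.
have t2 (u : R) : 0 <= u <= h -> traj f x (al' b2) b2 u = traj f x (al' b) b u.
  by apply: traj_unique => // s /andP[/ltW s0 sh]; rewrite b2b // a2a // s0.
have hh : 0 <= h <= h by rewrite h0' lexx.
pose P w := (\int[leb]_(t in seg h) (w t * g (traj f x (al' b) b t) (al' b t) (b t))%:E)%E.
have E1 : payoff f g r x a b = (P r + payoff f g (fun t => r (t + h)%R) z
    (sig z (fun t => b (t + h)%R)) (fun t => b (t + h)%R))%E.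
  rewrite (payoff_split x h0' wr Ca Cb) t1 // -/z; congr (_ + _)%E.
    apply: eq_integral => t /set_mem /= th.
    by rewrite t1 // aa //; case/andP: th.
  apply: payoff_eq_pos => //; first exact: control_shift.
  move=> t t0; split=> //; rewrite /a /paste.
  by rewrite gerDr leNgt t0 /= addrK.
have E2 : payoff f g r' x (al' b2) b2 = (P r' + payoff f g (fun t => r' (t + h)%R) z
    (fun t => al' b2 (t + h)%R) be)%E.
  rewrite (payoff_split x h0' wr' Ca2 Cb2) t2 // -/z; congr (_ + _)%E.
    apply: eq_integral => t /set_mem /= th.
    by rewrite t2 // a2a // b2b //; case/andP: th.
  apply: payoff_eq_pos => //; try exact: control_shift.
  move=> t t0; split=> //; rewrite /b2 /paste.
  by rewrite gerDr leNgt t0 /= addrK.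
have := Ha' b2 Cb2; rewrite E2 => H2.
have PI : (P r <= P r' + I%:E)%E.
  by apply: integral_running_le => //; [exact: measurable_seg|exact: segS_Rplus].
rewrite E1.
have Q1 := (Hsig z Oz).2 _ Cbh.
(* Three errors of [e / 3]: the choice of [sig], the reply [be] and, in [H2], the choice of
   [al']. *)
have Q2 : (V (fun t => r (t + h)) z + e / 3 <=
    (V (fun t => r' (t + h)) z - e / 3) + (D + 2 * (e / 3))).
  by have := HD z Oz; lra.
apply: le_trans (leeD PI Q1) _.
move: Q2; rewrite -lee_fin => Q2; apply: le_trans (leeD2l _ Q2) _.
rewrite [(_ + (D + _))%:E]EFinD.
apply: le_trans (leeD2l _ (leeD2r _ Hbe)) _.
rewrite addeACA -EFinD; apply: le_trans (leeD2r _ H2) _.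
rewrite -EFinD lee_fin; lra.
Qed.

End ControlledSystem.

(** * Weights *)

Section Weights.
Variable R : realType.
Local Notation leb := (@lebesgue_measure R).
Local Notation seg t := [set s : R | (0 <= s <= t)%R].
Implicit Types (r : R -> R).

Lemma ge0_integral_scale (F : R -> R) (l : R) : 0 < l -> measurable_fun (@Rplus R) F ->
  (forall t : R, 0 <= t -> 0 <= F t) ->
  (\int[leb]_(t in @Rplus R) (l * F (l * t)%R)%:E = \int[leb]_(t in @Rplus R) (F t)%:E)%E.
Proof.
move=> l0 mF F0.
have D : (fun t => l * t + 0) @^-1` (@Rplus R) = @Rplus R.
  by apply/seteqP; split=> t; rewrite /Rplus /= addr0 pmulr_rge0.
have mF' : measurable_fun (@Rplus R) (fun t => F (l * t + 0)).
  by have := @measurable_fun_affine R _ _ l 0 _ _ (@measurable_Rplus R) mF; rewrite D.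
rewrite [RHS](@ge0_integral_affine R l 0) //; first last.
- exact/measurable_EFinP.
- exact: measurable_Rplus.
rewrite D -ge0_integralZl_EFin //.
- by apply: eq_integral => t _; rewrite addr0 EFinM.
- exact: measurable_Rplus.
- by move=> t t0; rewrite lee_fin F0 // addr0 mulr_ge0 // ltW.
- exact/measurable_EFinP.
- exact: ltW.
Qed.

Lemma measurable_scale (F : R -> R) (l : R) : 0 < l -> measurable_fun (@Rplus R) F ->
  measurable_fun (@Rplus R) (fun t => F (l * t)).
Proof.
move=> l0 mF.
have D : (fun t => l * t + 0) @^-1` (@Rplus R) = @Rplus R.
  by apply/seteqP; split=> t; rewrite /Rplus /= addr0 pmulr_rge0.
have := @measurable_fun_affine R _ _ l 0 _ _ (@measurable_Rplus R) mF; rewrite D.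
by rewrite (_ : (fun t => F (l * t + 0)) = (fun t => F (l * t))) //; apply/funext => t; rewrite addr0.
Qed.

Lemma weight_scale r (l : R) : 0 < l -> weight r -> weight (rho_scale r l).
Proof.
move=> l0 [r0 [mr ir]]; split=> [t t0|].
  by apply: mulr_ge0; [exact: ltW|apply: r0; rewrite mulr_ge0 // ltW].
split; last by rewrite /rho_scale ge0_integral_scale.
by apply: measurable_funM => //; exact: measurable_scale.
Qed.

Lemma integral_scale_dist r r' (l : R) : 0 < l -> weight r -> weight r' ->
  (\int[leb]_(t in @Rplus R) `|rho_scale r l t - rho_scale r' l t|%:E =
   \int[leb]_(t in @Rplus R) `|r t - r' t|%:E)%E.
Proof.
move=> l0 wr wr'; rewrite -[RHS](ge0_integral_scale l0) //.
  apply: eq_integral => t _; rewrite /rho_scale -mulrBr normrM.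
  by rewrite (ger0_norm (ltW l0)).
by apply: measurableT_comp => //; apply: measurable_funB; [case: wr => _ []|case: wr' => _ []].
Qed.

Lemma density_weight r : density r -> weight r.
Proof. by move=> [r0 [mr ir]]; split=> //; split=> //; rewrite ir ltry. Qed.

Lemma integral_null_off0 (F : R -> R) : measurable_fun (@Rplus R) F ->
  (forall t : R, 0 < t -> F t = 0) -> (\int[leb]_(t in @Rplus R) (F t)%:E = 0)%E.
Proof.
move=> mF F0; rewrite RplusE -integral_itv_obnd_cbnd; last first.
  apply/measurable_EFinP; apply: measurable_funS mF; first exact: measurable_Rplus.
  by move=> t; rewrite /= in_itv /= andbT => /ltW.
apply: integral0_eq => t /=; rewrite in_itv /= andbT => t0.
by rewrite F0.
Qed.

Lemma integral_seg_cst (c h : R) : 0 <= h -> (\int[leb]_(t in seg h) c%:E = (c * h)%:E)%E.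
Proof.
move=> h0; rewrite segE integral_cst //= lebesgue_measure_itv /= lte_fin.
move: h0; rewrite le_eqVlt => /predU1P[<-|->].
  by rewrite ltxx mule0 mulr0.
by rewrite sube0.
Qed.

(** Not cut off at 0, unlike [varpi]: shifting by [h] yields literally the box of length [T - h]. *)
Definition box (c T : R) : R -> R := fun t => if t <= T then c else 0.

Lemma measurable_box c T (D : set R) : measurable_fun D (box c T).
Proof.
apply: measurable_funTS; rewrite /box.
apply: (measurable_fun_ifT (f := fun t : R => t <= T)) => //.
exact: measurable_fun_ler.
Qed.

Lemma integral_box (c T : R) : 0 <= c -> 0 <= T ->
  (\int[leb]_(t in @Rplus R) (box c T t)%:E = (c * T)%:E)%E.
Proof.
move=> c0 T0; rewrite (ge0_integral_split T0 (@measurable_box c T _)); last first.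
  by move=> t _; rewrite /box; case: ifP.
rewrite (_ : \int[leb]_(t in @Rplus R) _ = 0)%E.
  rewrite adde0 -integral_seg_cst //; apply: eq_integral => t /set_mem /= /andP[_ tT].
  by rewrite /box tT.
apply: integral_null_off0.
  by apply: measurable_shift => //; exact: measurable_box.
by move=> t t0; rewrite /box gerDr leNgt t0.
Qed.

Lemma weight_box (c T : R) : 0 <= c -> 0 <= T -> weight (box c T).
Proof.
move=> c0 T0; split=> [t _|]; first by rewrite /box; case: ifP.
split; first exact: measurable_box.
by rewrite integral_box // ltry.
Qed.

(** A node belongs to the step on its left, so shifting by [d] removes the first step except at time
    0. *)
Fixpoint steps (d : R) (cs : seq R) (t : R) : R :=
  if cs is c :: cs' then if t <= d then c else steps d cs' (t - d) else 0.

Lemma measurable_steps d cs : measurable_fun setT (steps d cs).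
Proof.
elim: cs => [|c cs IH] /=; first exact: measurable_cst.
apply: (measurable_fun_ifT (f := fun t : R => t <= d)) => //.
  exact: measurable_fun_ler.
apply: (measurableT_comp (f := steps d cs)) => //.
by apply: measurable_funB.
Qed.

Lemma steps_ge0 d cs t : all (fun c => 0 < c) cs -> 0 <= steps d cs t.
Proof.
elim: cs t => [//|c cs IH] t /= /andP[c0 cs0]; case: ifP => _; last exact: IH.
exact: ltW.
Qed.

Lemma integral_steps (d : R) cs : 0 < d -> all (fun c => 0 < c) cs ->
  (\int[leb]_(t in @Rplus R) (steps d cs t)%:E = (d * \sum_(c <- cs) c)%:E)%E.
Proof.
move=> d0; elim: cs => [|c cs IH].
  by move=> _; rewrite big_nil mulr0 integral0_eq.
move=> /= /andP[c0 cs0]; have d0' := ltW d0.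
have mS : measurable_fun (@Rplus R) (steps d (c :: cs)).
  by apply: measurable_funTS; exact: measurable_steps.
rewrite (ge0_integral_split d0' mS); last by move=> t _; apply: (@steps_ge0 d (c :: cs)) => /=; rewrite c0.
rewrite big_cons mulrDr EFinD mulrC -integral_seg_cst // -IH //; congr (_ + _)%E.
  by apply: eq_integral => t /set_mem /= /andP[_ ->].
rewrite RplusE -!integral_itv_obnd_cbnd //.
- apply: eq_integral => t /set_mem /=; rewrite in_itv /= andbT => t0.
  by rewrite gerDr leNgt t0 /= addrK.
- by apply/measurable_EFinP; apply: measurable_funTS; exact: measurable_steps.
- apply/measurable_EFinP; apply: measurable_funS (measurable_shift d0' mS).
    exact: measurable_Rplus.
  by move=> t; rewrite /= in_itv /= andbT => /ltW.
Qed.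

Lemma weight_steps (d : R) cs : 0 < d -> all (fun c => 0 < c) cs -> weight (steps d cs).
Proof.
move=> d0 cs0; split=> [t _|]; first exact: steps_ge0.
split; first by apply: measurable_funTS; exact: measurable_steps.
by rewrite integral_steps // ltry.
Qed.

End Weights.

(** * Abelian and Tauberian comparison *)

Section AbelTauber.
Variable R : realType.
Local Notation leb := (@lebesgue_measure R).
Local Notation seg t := [set s : R | (0 <= s <= t)%R].

Lemma eq_integral_Rplus (F G : R -> R) : (forall t : R, 0 <= t -> F t = G t) ->
  (\int[leb]_(t in @Rplus R) (F t)%:E = \int[leb]_(t in @Rplus R) (G t)%:E)%E.
Proof. by move=> E; apply: eq_integral => t /set_mem t0; rewrite E. Qed.

Lemma weight_eq (r r' : R -> R) : (forall t : R, 0 <= t -> r t = r' t) -> weight r -> weight r'.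
Proof.
move=> E [r0 [mr ir]]; split=> [t t0|]; first by rewrite -E // r0.
split; first by apply: eq_measurable_fun mr => t /set_mem; exact: E.
by rewrite -(eq_integral_Rplus E).
Qed.

Lemma weight0 : weight (fun=> 0 : R).
Proof. by split=> //; split; [exact: measurable_cst|rewrite integral0_eq]. Qed.

Lemma varpi_box (T t : R) : 0 <= t -> varpi T t = box T^-1 T t.
Proof. by move=> t0; rewrite /varpi t0. Qed.

Lemma weight_varpi (T : R) : 0 < T -> weight (varpi T).
Proof.
move=> T0; apply: (@weight_eq (box T^-1 T)) => [t t0|]; first by rewrite varpi_box.
by apply: weight_box; rewrite ?invr_ge0 ltW.
Qed.

Lemma integral_varpi (T : R) : 0 < T -> (\int[leb]_(t in @Rplus R) (varpi T t)%:E = 1)%E.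
Proof.
move=> T0; rewrite (eq_integral_Rplus (@varpi_box T)).
by rewrite integral_box ?invr_ge0 ?ltW // mulVf // gt_eqF.
Qed.

(** The game enters what follows only through these five properties of the value. *)
Variables (X : Type) (Om : set X) (V : (R -> R) -> X -> R).
Hypothesis V_ge0 : forall r x, weight r -> 0 <= V r x.
Hypothesis V_eq : forall r r', (forall t : R, 0 <= t -> r t = r' t) -> V r = V r'.
Hypothesis V_hom : forall r x (c : R), 0 < c -> weight r -> V (fun t => c * r t) x = c * V r x.
Hypothesis V_lip : forall r r' x (I : R), weight r -> weight r' ->
  (\int[leb]_(t in @Rplus R) `|r t - r' t|%:E <= I%:E)%E -> V r x <= V r' x + I.
Hypothesis V_step : forall r r' x (h I D : R), weight r -> weight r' -> Om x -> 0 < h ->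
  (\int[leb]_(t in seg h) `|r t - r' t|%:E <= I%:E)%E ->
  (forall z, Om z -> V (fun t => r (t + h)) z <= V (fun t => r' (t + h)) z + D) ->
  V r x <= V r' x + I + D.

Definition lim0 (G : R -> X -> R) (U : X -> R) := forall e : R, 0 < e ->
  exists2 d : R, 0 < d & forall l : R, 0 < l < d -> forall w, Om w -> `|G l w - U w| <= e.
Definition limoo (G : R -> X -> R) (U : X -> R) := forall e : R, 0 < e ->
  exists T0 : R, forall T : R, T0 < T -> forall w, Om w -> `|G T w - U w| <= e.

Lemma V_lip_norm r r' x (I : R) : weight r -> weight r' ->
  (\int[leb]_(t in @Rplus R) `|r t - r' t|%:E <= I%:E)%E -> `|V r x - V r' x| <= I.
Proof.
move=> wr wr' H; have h1 := V_lip x wr wr' H.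
have h2 : V r' x <= V r x + I.
  by apply: V_lip => //; apply: le_trans H; rewrite le_eqVlt; apply/orP; left;
    apply/eqP; apply: eq_integral => t _; rewrite distrC.
by rewrite ler_norml; apply/andP; split; lra.
Qed.

Lemma V_step_norm r r' x (h I D : R) : weight r -> weight r' -> Om x -> 0 < h ->
  (\int[leb]_(t in seg h) `|r t - r' t|%:E <= I%:E)%E ->
  (forall z, Om z -> `|V (fun t => r (t + h)) z - V (fun t => r' (t + h)) z| <= D) ->
  `|V r x - V r' x| <= I + D.
Proof.
move=> wr wr' Ox h0 H HD.
have h1 : V r x <= V r' x + I + D.
  apply: (V_step (h := h)) => // z /HD; rewrite ler_norml => /andP[_]; lra.
have h2 : V r' x <= V r x + I + D.
  apply: (V_step (h := h)) => //.
    by apply: le_trans H; rewrite le_eqVlt; apply/orP; left;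
      apply/eqP; apply: eq_integral => t _; rewrite distrC.
  by move=> z /HD; rewrite ler_norml => /andP[+ _]; lra.
by rewrite ler_norml; apply/andP; split; lra.
Qed.

Lemma V_ae r r' x : weight r -> weight r' -> (forall t : R, 0 < t -> r t = r' t) ->
  V r x = V r' x.
Proof.
move=> wr wr' E; apply/eqP; rewrite -subr_eq0 -normr_le0; apply: V_lip_norm => //.
rewrite integral_null_off0 //.
  by apply: measurableT_comp => //; apply: measurable_funB; [case: wr => _ []|case: wr' => _ []].
by move=> t t0; rewrite E // subrr normr0.
Qed.

(** Homogeneity with the factor 2 leaves no other value. *)
Lemma V0 x : V (fun=> 0) x = 0.
Proof.
have := @V_hom (fun=> 0) x 2 (ltr0n _ 2) weight0.
rewrite (V_eq (r' := fun=> 0)); last by move=> t _; rewrite mulr0.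
by lra.
Qed.

Lemma V_mass r x (M : R) : weight r -> (\int[leb]_(t in @Rplus R) (r t)%:E <= M%:E)%E ->
  V r x <= M.
Proof.
move=> wr H; have := @V_lip r (fun=> 0) x M wr weight0; rewrite V0 add0r; apply.
rewrite (eq_integral_Rplus (G := r)) // => t t0.
by rewrite subr0 ger0_norm // wr.1.
Qed.

Lemma V_box (c T : R) x : 0 < c -> 0 < T -> V (box c T) x = c * T * V (varpi T) x.
Proof.
move=> c0 T0; rewrite -V_hom ?mulr_gt0 //; last exact: weight_varpi.
rewrite (V_eq (r' := box c T)) // => t t0; rewrite varpi_box // /box.
by case: ifP; rewrite ?mulr0 // mulfK // gt_eqF.
Qed.

(** Recovers the bounds on [U] from convergence alone: values of densities lie in the closed
    interval [[0, 1]]. *)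
Lemma limoo_bounds U w : limoo (fun T => V (varpi T)) U -> Om w -> 0 <= U w <= 1.
Proof.
move=> H Ow.
have v01 e : 0 < e -> exists2 v, `|v - U w| <= e & 0 <= v <= 1.
  move=> e0; have [T0 HT] := H e e0.
  have T1 : 0 < `|T0| + 1 by rewrite ltr_wpDl.
  exists (V (varpi (`|T0| + 1)) w).
    by apply: HT => //; rewrite (le_lt_trans (ler_norm T0)) // ltrDl.
  rewrite V_ge0 ?V_mass //; try exact: weight_varpi.
  by rewrite integral_varpi.
apply/andP; split; apply/ler_addgt0Pr => e e0; have [v + /andP[v0 v1]] := v01 e e0;
  rewrite ler_norml => /andP[]; lra.
Qed.

Lemma box_lim0 U (c tau : R) : limoo (fun T => V (varpi T)) U -> 0 < c -> 0 < tau ->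
  lim0 (fun l => V (box (l * c) (tau / l))) (fun w => c * tau * U w).
Proof.
move=> H c0 t0 e e0; have ct0 : 0 < c * tau by rewrite mulr_gt0.
have [T0 HT] := H (e / (c * tau)) (divr_gt0 e0 ct0).
have T1 : 0 < `|T0| + 1 by rewrite ltr_wpDl.
exists (tau / (`|T0| + 1)); first by rewrite divr_gt0.
move=> l /andP[l0 ld] w Ow; have tl0 : 0 < tau / l by rewrite divr_gt0.
have lc0 : 0 < l * c by rewrite mulr_gt0.
rewrite V_box //.
have -> : l * c * (tau / l) = c * tau by field; rewrite gt_eqF.
rewrite -mulrBr normrM gtr0_norm // mulrC -ler_pdivlMr //; apply: HT => //.
rewrite ltr_pdivlMr // in ld; rewrite ltr_pdivlMr //.
apply: le_lt_trans ld; rewrite mulrC ler_pM2l // (le_trans (ler_norm T0)) //.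
by rewrite lerDl.
Qed.

Lemma steps_lim0 U (d : R) cs : limoo (fun T => V (varpi T)) U -> 0 < d ->
  all (fun c => 0 < c) cs ->
  lim0 (fun l => V (rho_scale (steps d cs) l)) (fun w => d * (\sum_(c <- cs) c) * U w).
Proof.
move=> H d0; elim: cs => [|c cs IH] /=.
  move=> _ e e0; exists 1 => // l _ w _.
  rewrite (V_eq (r' := fun=> 0)); last by move=> t _; rewrite /rho_scale /= mulr0.
  by rewrite V0 big_nil mulr0 mul0r subrr normr0 ltW.
move=> /andP[c0 cs0]; move: {IH} (IH cs0); set m := d * \sum_(c <- cs) c => IH.
rewrite big_cons mulrDr -/m.
(* An empty tail has mass 0 and no box of positive length represents it, so the last step is treated
   as a box by itself. *)
have [cs_nil|cs_nz] := eqVneq cs [::].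
  move=> e e0; have [dl dl0 Hd] := box_lim0 H c0 d0 e0.
  exists dl => // l ll w Ow; have := Hd l ll w Ow.
  have /andP[l0 _] := ll.
  rewrite (V_eq (r' := rho_scale (steps d (c :: cs)) l)).
    by rewrite /m cs_nil big_nil mulr0 addr0 (mulrC d).
  move=> t t0; rewrite /box /rho_scale cs_nil /= ler_pdivlMr // (mulrC t).
  by case: ifP; rewrite ?mulr0.
have m0 : 0 < m.
  rewrite /m; case: (cs) cs0 cs_nz => [//|c' cs'] /= /andP[c'0 /allP cs0'] _.
  rewrite big_cons mulr_gt0 // ltr_pwDl // big_seq; apply: sumr_ge0 => i /cs0'.
  exact: ltW.
move=> e e0; have e30 : 0 < e / 3 by rewrite divr_gt0.
have [d1 d10 H1] := IH _ e30.
have [d2 d20 H2] := box_lim0 H c0 (divr_gt0 m0 c0) e30.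
have [d3 d30 H3] := box_lim0 H c0 (addr_gt0 d0 (divr_gt0 m0 c0)) e30.
exists (Num.min d1 (Num.min d2 d3)); first by rewrite !lt_min d10 d20.
move=> l /andP[l0]; rewrite !lt_min => /and3P[l1 l2 l3] w Ow.
set r := rho_scale (steps d (c :: cs)) l.
(* [m / c] is the length that the tail mass fills at height [c]. The two weights agree on
   [[0, d / l]], and both remainders have values near [m * U]. *)
set r' := box (l * c) ((d + m / c) / l).
have mc0 : 0 < m / c by rewrite divr_gt0.
have wr : weight r by apply: weight_scale => //; apply: weight_steps => //=; rewrite c0.
have wr' : weight r'.
  by apply: weight_box; apply: ltW; [rewrite mulr_gt0|rewrite divr_gt0 // addr_gt0].
have dl0 : 0 < d / l by rewrite divr_gt0.
have close : `|V r w - V r' w| <= 0 + (e / 3 + e / 3).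
  apply: (V_step_norm wr wr' Ow dl0) => [|z Oz].
    rewrite integral0_eq // => t /= /andP[t0 tdl].
    rewrite /r /r' /rho_scale /box /=.
    rewrite ler_pdivlMr // mulrC in tdl.
    rewrite tdl ler_pdivlMr // (mulrC t) (le_trans tdl) ?lerDl ?ltW //.
    by rewrite subrr normr0.
  have -> : V (fun t => r (t + d / l)) z = V (rho_scale (steps d cs) l) z.
    apply: V_ae.
    - exact: weight_shift (ltW dl0) wr.
    - by apply: weight_scale => //; exact: weight_steps.
    move=> t t0; rewrite /r /rho_scale /= mulrDr mulrCA mulfV ?gt_eqF // mulr1.
    by rewrite gerDr leNgt mulr_gt0 //= addrK.
  have -> : V (fun t => r' (t + d / l)) z = V (box (l * c) ((m / c) / l)) z.
    rewrite (V_eq (r' := box (l * c) (m / c / l))) // => t t0.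
    by rewrite /r' /box mulrDl [d / l + _]addrC lerD2r.
  have := H1 l _ z Oz; rewrite l0 l1 => /(_ isT) h1.
  have := H2 l _ z Oz; rewrite l0 l2 => /(_ isT).
  rewrite (mulrC c) divfK ?gt_eqF // => h2.
  rewrite -(subrK (m * U z) (V (rho_scale _ _) _)) -addrA.
  apply: le_trans (ler_normD _ _) _; apply: lerD => //.
  by rewrite distrC.
have := H3 l _ w Ow; rewrite l0 l3 => /(_ isT).
have -> : c * (d + m / c) = d * c + m by field; rewrite gt_eqF.
rewrite -/r' => h3.
rewrite -(subrK (V r' w) (V r w)) -addrA; apply: le_trans (ler_normD _ _) _.
apply: le_trans (lerD close h3) _; lra.
Qed.

(** Scaling preserves L1 distances, so one step approximation serves every [l]. Its mass differs
    from 1 by at most the approximation error, which is harmless because [U] lies in [[0, 1]]. *)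
Lemma abel U (mu : R -> R) : limoo (fun T => V (varpi T)) U -> density mu ->
  (forall e : R, 0 < e -> exists d cs, [/\ 0 < d, all (fun c => 0 < c) cs &
     (\int[leb]_(t in @Rplus R) `|mu t - steps d cs t|%:E <= e%:E)%E]) ->
  lim0 (fun l => V (rho_scale mu l)) U.
Proof.
move=> H dmu apx e e0; have wmu := density_weight dmu.
have e30 : 0 < e / 3 by rewrite divr_gt0.
have [d [cs [d0 cs0 Hcs]]] := apx _ e30.
have ws := weight_steps d0 cs0.
have [dl dl0 Hd] := steps_lim0 H d0 cs0 e30.
exists dl => // l ll w Ow; have /andP[l0 _] := ll.
have h1 := Hd l ll w Ow.
have h2 : `|V (rho_scale mu l) w - V (rho_scale (steps d cs) l) w| <= e / 3.
  by apply: V_lip_norm; rewrite ?integral_scale_dist //; exact: weight_scale.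
have h3 : `|d * (\sum_(c <- cs) c) - 1| <= e / 3.
  have h4 r r' : weight r -> weight r' ->
      (\int[leb]_(t in @Rplus R) (r t)%:E <= \int[leb]_(t in @Rplus R) (r' t)%:E
        + \int[leb]_(t in @Rplus R) `|r t - r' t|%:E)%E.
    move=> wr wr'; have mr := wr.2.1; have mr' := wr'.2.1.
    have mD : measurable_fun (@Rplus R) (fun t => `|r t - r' t|).
      by apply: measurableT_comp => //; exact: measurable_funB.
    have mR := @measurable_Rplus R.
    rewrite -ge0_integralD //; first last.
    - exact/measurable_EFinP.
    - exact/measurable_EFinP.
    - by move=> t t0; rewrite lee_fin wr'.1.
    apply: ge0_le_integral => //.
    - by move=> t t0; rewrite lee_fin wr.1.
    - exact/measurable_EFinP.
    - by apply: emeasurable_funD; exact/measurable_EFinP.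
    - by move=> t t0; rewrite -EFinD lee_fin -lerBlDl ler_norm.
  have [_ [_ imu]] := dmu.
  have := h4 _ _ wmu ws; have := h4 _ _ ws wmu.
  rewrite imu integral_steps //.
  rewrite (eq_integral_Rplus (G := fun t => `|mu t - steps d cs t|)); last by move=> t _; rewrite distrC.
  move=> /le_trans/(_ (leeD2l _ Hcs)) a1 /le_trans/(_ (leeD2l _ Hcs)).
  move: a1; rewrite -!EFinD !lee_fin => a1 a2.
  by rewrite ler_norml; apply/andP; split; lra.
have /andP[U0 U1] := limoo_bounds H Ow.
set S := V (rho_scale (steps d cs) l) w in h1 h2.
set M := d * _ in h1 h3.
have h5 : `|M * U w - U w| <= e / 3.
  by rewrite -[X in _ - X]mul1r -mulrBl normrM (ger0_norm U0) (le_trans _ h3) // ler_piMr.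
move: h1 h2 h5; rewrite !ler_norml => /andP[? ?] /andP[? ?] /andP[? ?].
by apply/andP; split; lra.
Qed.

(** A tail is, up to its mass [m], the density itself slowed down by [k]. With [k <= 1] the scaling
    parameter can only decrease, so it stays where values are known to be near [U]. *)
Definition self_similar (mu : R -> R) := forall s : R, 0 <= s ->
  exists k m, [/\ 0 < k <= 1, 0 < m & forall t : R, 0 <= t -> mu (t + s) = m * (k * mu (k * t))].

Lemma self_similar_tail (mu : R -> R) (s k m : R) : density mu -> 0 <= s -> 0 < k -> 0 < m ->
  (forall t : R, 0 <= t -> mu (t + s) = m * (k * mu (k * t))) ->
  (\int[leb]_(t in @Rplus R) (mu (t + s)%R)%:E = m%:E)%E.
Proof.
move=> dmu s0 k0 m0 E; have [mu0 [mmu imu]] := dmu.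
have [w0 [mw _]] := weight_scale k0 (density_weight dmu).
rewrite (eq_integral_Rplus E); under eq_integral do rewrite EFinM.
rewrite ge0_integralZl_EFin.
- by rewrite ge0_integral_scale // imu mule1.
- exact: measurable_Rplus.
- by move=> t t0; rewrite lee_fin; exact: w0.
- exact/measurable_EFinP.
- exact: ltW.
Qed.

(* The mass of [mu] beyond [s] is [m]; comparing [mu] with its value [mu0] at 0 locates [m]. *)
Lemma self_similar_mass (mu : R -> R) (mu0 C s k m : R) : density mu -> 0 < s -> 0 < k -> 0 < m ->
  0 <= mu0 -> 0 <= C ->
  (forall t : R, 0 <= t -> mu0 * (1 - C * t) <= mu t <= mu0) ->
  (forall t : R, 0 <= t -> mu (t + s) = m * (k * mu (k * t))) ->
  1 - mu0 * s <= m <= 1 - mu0 * (1 - C * s) * s.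
Proof.
move=> dmu s0 k0 m0 mu00 C0 B E; have [mup [mmu imu]] := dmu; have s0' := ltW s0.
have := ge0_integral_split s0' mmu mup; rewrite imu (self_similar_tail dmu s0' k0 m0 E).
have msg := measurable_seg s.
have mS : measurable_fun (seg s) (EFin \o mu).
  apply/measurable_EFinP; apply: measurable_funS mmu; first exact: measurable_Rplus.
  exact: segS_Rplus.
have up : (\int[leb]_(t in seg s) (mu t)%:E <= (mu0 * s)%:E)%E.
  rewrite -integral_seg_cst //; apply: ge0_le_integral => //.
  - by move=> t /andP[t0 _]; rewrite lee_fin mup.
  - by move=> t /andP[t0 _]; rewrite lee_fin; case/andP: (B t t0).
have lo : ((mu0 * (1 - C * s) * s)%:E <= \int[leb]_(t in seg s) (mu t)%:E)%E.
  have [neg|pos] := leP (1 - C * s) 0.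
    apply: le_trans (integral_ge0 _ _); first by rewrite lee_fin mulr_le0_ge0 // mulr_ge0_le0.
    by move=> t /andP[t0 _]; rewrite lee_fin mup.
  rewrite -integral_seg_cst //; apply: ge0_le_integral => //.
  - by move=> t _; rewrite lee_fin mulr_ge0 // ltW.
  - move=> t /andP[t0 ts]; rewrite lee_fin; have /andP[+ _] := B t t0; apply: le_trans.
    by rewrite ler_wpM2l // lerB // ler_wpM2l.
have fin : (\int[leb]_(t in seg s) (mu t)%:E)%E \is a fin_num.
  rewrite ge0_fin_numE; first by apply: le_lt_trans up _; rewrite ltry.
  by apply: integral_ge0 => t /andP[t0 _]; rewrite lee_fin mup.
move: up lo; rewrite -(fineK fin) -EFinD !lee_fin => up lo [e1].
by apply/andP; split; lra.
Qed.

(* [d_k = sup |V(box (1/tau) (k tau)) - k U|] satisfies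
   [d_k <= d_(k-1) + 2 k eps + 2 C' / k]; the harmonic sum is bounded by [min k M + k / M]. *)
Lemma tauber_blocks U (mu : R -> R) (mu0 C eps dl tau : R) (M : nat) : density mu ->
  0 < mu0 -> 0 <= C -> (0 < M)%N ->
  (forall t : R, 0 <= t -> mu0 * (1 - C * t) <= mu t <= mu0) -> self_similar mu ->
  (forall w, Om w -> 0 <= U w <= 1) -> 0 <= eps -> 0 < tau ->
  (forall l : R, 0 < l < dl -> forall w, Om w -> `|V (rho_scale mu l) w - U w| <= eps) ->
  1 / (mu0 * tau) < dl ->
  forall k : nat, forall w, Om w -> `|V (box tau^-1 (k%:R * tau)) w - k%:R * U w| <=
    k%:R * k.+1%:R * eps + 2 * (C / mu0) * ((minn k M)%:R + k%:R / M%:R).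
Proof.
move=> dmu mu00 C0 M0 B SS U01 eps0 tau0 H Hdl; have wmu := density_weight dmu.
have ti0 : 0 <= tau^-1 by rewrite invr_ge0 ltW.
elim=> [|k IH] w Ow.
  rewrite mul0r (@V_ae _ (fun=> 0)); first by rewrite V0 !mul0r subrr normr0 min0n addr0 mulr0 add0r.
  - exact: weight_box.
  - exact: weight0.
  - by move=> t t0; rewrite /box leNgt t0.
set K : R := k.+1%:R; have K0 : 0 < K by rewrite ltr0n.
have K1 : 1 <= K by rewrite ler1n.
have kK : k%:R = K - 1 :> R by rewrite /K -natr1 addrK.
(* This scale gives [K * rho_scale mu l] the height [tau^-1] of the box at 0 when [mu] starts at
   [mu0]; it is at most [1 / (mu0 * tau)]. *)
pose l := (K * mu0 * tau)^-1.
have l0 : 0 < l by rewrite invr_gt0 !mulr_gt0.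
have lmt : K * l * mu0 = tau^-1 by rewrite /l; field; rewrite !gt_eqF.
have ldl : l < dl.
  apply: le_lt_trans Hdl; rewrite div1r lef_pV2 ?posrE ?mulr_gt0 // -mulrA ler_peMl //.
  by rewrite mulr_ge0 // ltW.
(* The length of one block in the time of [mu]. *)
pose s := l * tau; have s0 : 0 < s by rewrite mulr_gt0.
have sE : s = (K * mu0)^-1 by rewrite /s /l; field; rewrite !gt_eqF.
have [kap [m [/andP[kap0 kap1] m0 E]]] := SS s (ltW s0).
have /andP[mlo mup] := self_similar_mass dmu s0 kap0 m0 (ltW mu00) C0 B E.
pose r := fun t => K * rho_scale mu l t.
have wsl := weight_scale l0 wmu.
have wr : weight r by exact: weight_mul.
have wb : weight (box tau^-1 (K * tau)) by apply: weight_box => //; rewrite mulr_ge0 // ltW.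
have Vr : V r w = K * V (rho_scale mu l) w by exact: V_hom.
set D := k%:R * k.+1%:R * eps + 2 * (C / mu0) * ((minn k M)%:R + k%:R / M%:R) in IH.
(* Within the block [mu] drops by at most [mu0 * C * s] below [mu0], so the L1 error is at most
   [C * s], with [s = (K * mu0)^-1]. *)
have HI : (\int[leb]_(t in seg tau) `|box tau^-1 (K * tau) t - r t|%:E <= (C / mu0 / K)%:E)%E.
  have bd : (C / mu0 / K)%:E = (\int[leb]_(t in seg tau) (tau^-1 * C * s)%:E)%E.
    rewrite integral_seg_cst ?ltW // sE; congr _%:E; field.
    by rewrite !gt_eqF.
  rewrite bd; apply: ge0_le_integral => //.
  - exact: measurable_seg.
  - apply/measurable_EFinP; apply: (measurable_funS (@measurable_Rplus R)).
      exact: segS_Rplus.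
    apply: measurableT_comp => //; apply: measurable_funB; first exact: measurable_box.
    by case: wr => _ [].
  - move=> t /andP[t0 tt]; rewrite lee_fin /box.
    have -> : t <= K * tau by rewrite (le_trans tt) // ler_peMl // ltW.
    have lt0 : 0 <= l * t by rewrite mulr_ge0 // ltW.
    have /andP[b1 b2] := B (l * t) lt0.
    rewrite /r /rho_scale -lmt -mulrA -mulrA -mulrBr normrM (ger0_norm (ltW K0)).
    rewrite -mulrBr normrM (ger0_norm (ltW l0)) ger0_norm ?subr_ge0 //.
    have st : l * t <= s by rewrite /s ler_pM2l.
    have : mu0 - mu (l * t) <= mu0 * C * s.
      by have := ler_wpM2l (mulr_ge0 (ltW mu00) C0) st; lra.
    move=> h; rewrite -!mulrA !ler_pM2l //.
    by rewrite -!mulrA in h.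
have HD z : Om z -> `|V (fun t => box tau^-1 (K * tau) (t + tau)) z - V (fun t => r (t + tau)) z|
    <= D + C / mu0 / K + K * eps.
  move=> Oz.
  rewrite (V_eq (r' := box tau^-1 (k%:R * tau))); last first.
    by move=> t t0; rewrite /box kK mulrBl mul1r lerBrDr.
  have kl0 : 0 < kap * l by rewrite mulr_gt0.
  (* The tail of [r] is a scaled [mu] again, now of mass [K * m], to be compared with a box of mass
     [k]. *)
  rewrite (V_eq (r := fun t => r (t + tau)) (r' := fun t => (K * m) * rho_scale mu (kap * l) t));
    last first.
    move=> t t0; rewrite /r /rho_scale mulrDr -/s E; last by rewrite mulr_ge0 // ltW.
    by rewrite !mulrA; congr (_ * _); ring.
  rewrite V_hom ?mulr_gt0 //; last exact: weight_scale.
  have hk : `|V (rho_scale mu (kap * l)) z - U z| <= eps.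
    by apply: H => //; rewrite kl0 (le_lt_trans _ ldl) // ler_piMl // ltW.
  have := IH z Oz; have /andP[U0 U1] := U01 z Oz.
  (* The masses [k] and [K * m] differ by at most [C / mu0 / K], as much as the error on the block;
     hence the factor 2 in the bound. *)
  have Km1 : k%:R <= K * m.
    rewrite kK; have := ler_wpM2l (ltW K0) mlo.
    by rewrite sE (_ : K * (1 - mu0 * (K * mu0)^-1) = K - 1) //; field; rewrite !gt_eqF.
  have Km2 : K * m <= k%:R + C / mu0 / K.
    rewrite kK; have := ler_wpM2l (ltW K0) mup.
    by rewrite sE (_ : K * (1 - _) = K - 1 + C / mu0 / K) //; field; rewrite !gt_eqF.
  have KmK : K * m <= K.
    rewrite -[leRHS]mulr1 ler_pM2l // -lee_fin -(self_similar_tail dmu (ltW s0) kap0 m0 E).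
    have -> : 1%:E = (\int[leb]_(t in @Rplus R) (mu t)%:E)%E by rewrite dmu.2.2.
    rewrite [leRHS](ge0_integral_split (ltW s0) dmu.2.1 dmu.1) leeDr //.
    by apply: integral_ge0 => t /andP[t0 _]; rewrite lee_fin dmu.1.
  set Vk := V (rho_scale _ _) z in hk *; set W := V (box _ _) z => hW.
  have -> : W - K * m * Vk = (W - k%:R * U z) + (k%:R - K * m) * U z + K * m * (U z - Vk) by ring.
  apply: le_trans (ler_normD _ _) _; apply: lerD.
    apply: le_trans (ler_normD _ _) _; apply: lerD => //.
    rewrite normrM (ger0_norm U0) distrC ger0_norm ?subr_ge0 //.
    apply: le_trans (_ : K * m - k%:R <= _); first by rewrite ler_piMr // subr_ge0.
    by rewrite lerBlDl.
  rewrite normrM distrC (ger0_norm (ltW _)) ?mulr_gt0 //.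
  by apply: ler_pM => //; rewrite mulr_ge0 // ltW.
have h1 := V_step_norm wb wr Ow tau0 HI HD.
have l0dl : 0 < l < dl by rewrite l0.
have h2 : `|V r w - K * U w| <= K * eps.
  by rewrite Vr -mulrBr normrM (gtr0_norm K0) ler_pM2l // H.
have C'0 : 0 <= C / mu0 by rewrite divr_ge0 // ltW.
(* The first [M] reciprocals are estimated by 1, the later ones by [1 / M]. *)
have harm : K^-1 <= (minn k.+1 M)%:R - (minn k M)%:R + M%:R^-1.
  have [kM|Mk] := leqP k.+1 M.
    rewrite (minn_idPl (ltnW kM)) -/K kK.
    have -> : K - (K - 1) = 1 by ring.
    have h : K^-1 <= 1 by rewrite invf_le1.
    by rewrite (le_trans h) // lerDl invr_ge0.
  have -> : minn k M = M by apply/minn_idPr; rewrite -ltnS.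
  by rewrite subrr add0r lef_pV2 ?posrE ?ltr0n // ler_nat ltnW.
rewrite -(subrK (V r w) (V (box _ _) w)) -addrA.
apply: le_trans (ler_normD _ _) _; apply: le_trans (lerD h1 h2) _.
rewrite /D -/K kK -[k.+2%:R]natr1 -/K.
have := ler_wpM2l C'0 harm.
set a := (minn k M)%:R; set b := (minn k.+1 M)%:R; set Mi := M%:R^-1; set c' := C / mu0.
set q := c' / K => hh; rewrite -subr_ge0.
have -> : K * (K + 1) * eps + 2 * c' * (b + K * Mi) -
  (q + ((K - 1) * K * eps + 2 * c' * (a + (K - 1) * Mi) + q + K * eps) + K * eps) =
  2 * (c' * (b - a + Mi) - q) by ring.
by rewrite mulr_ge0 // subr_ge0.
Qed.

Lemma lim0_bounds U mu w : density mu -> lim0 (fun l => V (rho_scale mu l)) U -> Om w ->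
  0 <= U w <= 1.
Proof.
move=> dmu H Ow; have wmu := density_weight dmu.
have v01 e : 0 < e -> exists2 v, `|v - U w| <= e & 0 <= v <= 1.
  move=> e0; have [d d0 Hd] := H e e0.
  have d20 : 0 < d / 2 by rewrite divr_gt0.
  exists (V (rho_scale mu (d / 2)) w).
    by apply: Hd => //; rewrite d20 ltr_pdivrMr // mulr_natr mulr2n ltrDl.
  have wd := weight_scale d20 wmu.
  rewrite V_ge0 // V_mass // /rho_scale ge0_integral_scale //.
  - by rewrite dmu.2.2.
  - exact: dmu.2.1.
  - exact: dmu.1.
apply/andP; split; apply/ler_addgt0Pr => e e0; have [v + /andP[v0 v1]] := v01 e e0;
  rewrite ler_norml => /andP[]; lra.
Qed.

Lemma tauber U (mu : R -> R) (mu0 C : R) : density mu -> 0 < mu0 -> 0 <= C ->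
  (forall t : R, 0 <= t -> mu0 * (1 - C * t) <= mu t <= mu0) -> self_similar mu ->
  lim0 (fun l => V (rho_scale mu l)) U -> limoo (fun T => V (varpi T)) U.
Proof.
move=> dmu mu00 C0 B SS H e e0.
have U01 w := @lim0_bounds U mu w dmu H.
set c := C / mu0; have c0 : 0 <= c by rewrite divr_ge0 // ltW.
(* With [N = M * M] blocks the harmonic bound is [2 * M]; the resulting error [4 * c * M] is at most
   [N * e / 2] once [8 * c <= M * e]. *)
pose M := (Num.truncn (8 * c / e)).+1.
have M0 : 0 < M%:R :> R by rewrite ltr0n.
have Mc : 8 * c < M%:R * e by rewrite -ltr_pdivrMr // truncnS_gt.
pose N := (M * M)%N.
have NE : N%:R = M%:R * M%:R :> R by rewrite natrM.
have N0 : 0 < N%:R :> R by rewrite NE mulr_gt0.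
have N10 : 0 < N.+1%:R :> R by rewrite ltr0n.
(* [N] is fixed before the accuracy of the values, so that the accumulated [N * (N + 1) * eps] is
   exactly [N * e / 2]. *)
pose eps := e / 2 / N.+1%:R; have eps0 : 0 < eps by rewrite !divr_gt0.
have [d d0 Hd] := H eps eps0.
(* For larger [T] the blocks are so long that every scale met in the induction is below [d]. *)
exists (N%:R / (mu0 * d)) => T hT w Ow.
have T0 : 0 < T by apply: le_lt_trans hT; rewrite ltW // divr_gt0 // mulr_gt0.
pose tau := T / N%:R; have tau0 : 0 < tau by rewrite divr_gt0.
have small : 1 / (mu0 * tau) < d.
  rewrite ltr_pdivrMr; last exact: mulr_gt0.
  move: hT; rewrite /tau ltr_pdivrMr ?mulr_gt0 // => hT.
  have -> : d * (mu0 * (T / N%:R)) = T * (mu0 * d) / N%:R by ring.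
  by rewrite ltr_pdivlMr // mul1r.
have := @tauber_blocks U mu mu0 C eps d tau M dmu mu00 C0 isT B SS U01 (ltW eps0) tau0 Hd small N w Ow.
rewrite -/c.
have NtT : N%:R * tau = T by rewrite /tau mulrC divfK // gt_eqF.
rewrite NtT V_box ?invr_gt0 //.
have -> : tau^-1 * T = N%:R by rewrite -NtT mulrCA mulVf ?mulr1 // gt_eqF.
have -> : minn N M = M by apply/minn_idPr; rewrite /N leq_pmulr.
rewrite -mulrBr normrM (gtr0_norm N0) => h.
have : N%:R * `|V (varpi T) w - U w| <= N%:R * e; last by rewrite ler_pM2l.
apply: le_trans h _.
have -> : N%:R * N.+1%:R * eps = N%:R * (e / 2).
  by rewrite /eps; field; rewrite gt_eqF.
have -> : N%:R / M%:R = M%:R :> R by rewrite NE mulfK // gt_eqF.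
have : M%:R * (8 * c) <= M%:R * (M%:R * e) by rewrite ler_pM2l // ltW.
rewrite NE; set m := M%:R; nra.
Qed.

End AbelTauber.

(** * Exponential, uniform and power densities *)

Section Densities.
Variable R : realType.
Local Notation leb := (@lebesgue_measure R).
Local Notation seg t := [set s : R | (0 <= s <= t)%R].

(** [pi_exp lam] unfolds to [rho_scale exp_density lam]. *)
Definition exp_density : R -> R := fun t => expR (- t).

Lemma exp_densityP : density exp_density.
Proof.
have cE : continuous exp_density.
  by move=> x; apply: continuous_comp; [exact: opp_continuous|exact: continuous_expR].
split=> [t _|]; first exact: expR_ge0.
split; first by apply: measurable_funTS; exact: continuous_measurable_fun.
rewrite RplusE (@ge0_continuous_FTC2y _ _ (fun x => - exp_density x) 0 0) //.
- by rewrite /exp_density oppr0 expR0 EFinN oppeK add0e.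
- by move=> x _; exact: expR_ge0.
- exact: continuous_subspaceT.
- by rewrite -oppr0; apply: cvgN; exact: cvgr_expR.
- by apply: cvgN; apply: cvg_at_right_filter; exact: cE.
- move=> x _; rewrite derive1E /exp_density.
  have dF : is_derive x (1 : R) (fun x : R => - expR (- x)) (expR (- x)).
    by apply: is_derive_eq; rewrite /GRing.scale /=; ring.
  by have [_ ->] := dF.
Qed.

Lemma exp_density_bounds (t : R) : 0 <= t -> 1 * (1 - 1 * t) <= exp_density t <= 1.
Proof.
move=> t0; rewrite !mul1r expR_ge1Dx /= /exp_density.
by rewrite -[leRHS]expR0 ler_expR oppr_le0.
Qed.

Lemma exp_density_self_similar : self_similar exp_density.
Proof.
move=> s s0; exists 1, (expR (- s)); split; rewrite ?expR_gt0 ?ltr01 //= => t t0.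
by rewrite !mul1r -expRD /exp_density opprD addrC.
Qed.

Lemma varpi1_density : density (varpi (1 : R)).
Proof.
have [w0 [mw _]] := weight_varpi (@ltr01 R).
by split=> //; split=> //; exact: integral_varpi.
Qed.

Lemma varpi1_piecewise_continuous : piecewise_continuous (varpi (1 : R)).
Proof.
move=> u v u0 uv; exists [:: 1]; split.
  move=> t /andP[ut _]; rewrite inE => t1.
  have t0 : 0 < t by exact: lt_le_trans ut.
  have [t1'|t1'] := ltP t 1.
    apply: cvg_near_cst; near=> x; rewrite /varpi.
    have x0 : 0 < x by near: x; exact: lt_nbhsr.
    have x1 : x < 1 by near: x; exact: lt_nbhsl.
    by rewrite (ltW x0) (ltW x1) (ltW t0) (ltW t1').
  have {}t1' : 1 < t by rewrite lt_neqAle eq_sym t1.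
  apply: cvg_near_cst; near=> x; rewrite /varpi.
  have x1 : 1 < x by near: x; exact: lt_nbhsr.
  by rewrite [x <= 1]leNgt x1 [t <= 1]leNgt t1' !andbF.
move=> t; rewrite inE => /eqP ->; split.
  exists 1; apply: cvg_near_cst; near=> x; rewrite /varpi.
  have x0 : 0 < x by near: x; apply: nbhs_left_gt; exact: ltr01.
  have x1 : x < 1 by near: x; exact: nbhs_left_lt.
  by rewrite (ltW x0) (ltW x1) invr1.
exists 0; apply: cvg_near_cst; near=> x; rewrite /varpi.
have x1 : 1 < x by near: x; exact: nbhs_right_gt.
by rewrite [x <= 1]leNgt x1 andbF.
Unshelve. all: by end_near. Qed.

Lemma varpi_scale (T t : R) : 0 < T -> 0 <= t -> varpi T t = rho_scale (varpi 1) T^-1 t.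
Proof.
move=> T0 t0; rewrite /rho_scale /varpi t0 /= invr1 (mulrC T^-1 t) ler_pdivrMr // mul1r.
by rewrite mulr_ge0 ?invr_ge0 ?(ltW T0) //=; case: ifP; rewrite ?mulr1 ?mulr0.
Qed.

Section PowerDensity.
Variables (rho : R -> R) (al be ga : R).
Hypotheses (al0 : 0 < al) (be0 : 0 < be) (ga0 : 0 < ga).
Hypothesis rhoE : forall t : R, 0 <= t -> rho t = (al + be * t) `^ (- ga).
Hypothesis drho : density rho.

(** Bernoulli's inequality for the exponent [- ga], from [ln (1 + u) <= u] and [1 + x <= expR x]. *)
Lemma power_bounds (t : R) : 0 <= t ->
  al `^ (- ga) * (1 - ga * be / al * t) <= rho t <= al `^ (- ga).
Proof.
move=> t0; rewrite rhoE //.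
pose u := be / al * t; have u0 : 0 <= u by rewrite mulr_ge0 // divr_ge0 // ltW.
have -> : al + be * t = al * (1 + u) by rewrite /u; field; rewrite gt_eqF.
have u1 : 0 < 1 + u by rewrite ltr_pwDl.
rewrite (powRM _ (ltW al0) (ltW u1)); set P := al `^ _.
have P0 : 0 < P by exact: powR_gt0.
have E : (1 + u) `^ (- ga) = expR (- ga * ln (1 + u)) by rewrite /powR gt_eqF.
have lo : 1 - ga * u <= (1 + u) `^ (- ga).
  rewrite E; apply: le_trans (expR_ge1Dx _); rewrite lerD2l mulNr lerN2 ler_pM2l //.
  by apply: le_ln1Dx; apply: lt_le_trans u0.
have hi : (1 + u) `^ (- ga) <= 1.
  rewrite E -[leRHS]expR0 ler_expR mulNr oppr_le0 mulr_ge0 ?(ltW ga0) //.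
  by apply: ln_ge0; rewrite lerDl.
rewrite ler_pM2l // (_ : ga * be / al * t = ga * u); last by rewrite /u; ring.
by rewrite lo /= -[leRHS]mulr1 ler_pM2l.
Qed.

(** With [k = al / (al + be * s)] one has [al + be * (t + s) = k^-1 * (al + be * (k * t))]. *)
Lemma power_similar (s : R) : 0 <= s -> exists2 m, 0 < m & forall t : R, 0 <= t ->
  rho (t + s) = m * (al / (al + be * s) * rho (al / (al + be * s) * t)).
Proof.
move=> s0; have d0 : 0 < al + be * s by rewrite ltr_pwDl // mulr_ge0 // ltW.
set k := al / (al + be * s); have k0 : 0 < k by rewrite divr_gt0.
exists (k^-1 `^ (- ga) / k); first by rewrite divr_gt0 // powR_gt0 // invr_gt0.
move=> t t0; have kt0 : 0 <= k * t by rewrite mulr_ge0 // ltW.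
have ki0 : 0 <= k^-1 by rewrite invr_ge0 ltW.
have ab0 : 0 <= al + be * (k * t) by rewrite addr_ge0 ?(ltW al0) // mulr_ge0 // ltW.
rewrite rhoE ?addr_ge0 // (rhoE kt0) [RHS]mulrA divfK ?gt_eqF // -(powRM _ ki0 ab0).
by congr (_ `^ _); rewrite /k; field; rewrite !gt_eqF.
Qed.

Lemma power_self_similar : self_similar rho.
Proof.
move=> s s0; have [m m0 E] := power_similar s0.
have d0 : 0 < al + be * s by rewrite ltr_pwDl // mulr_ge0 // ltW.
exists (al / (al + be * s)), m; split=> //.
by rewrite divr_gt0 //= ler_pdivrMr // mul1r lerDl mulr_ge0 // ltW.
Qed.

(** The normalisation in [rho_shift] divides by exactly the tail mass [m]; what remains is a scaling
    whose factor tends to 0 as [T] grows. *)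
Lemma power_shift (T t : R) : 0 <= T -> 0 <= t ->
  rho_shift rho T t = rho_scale rho (al / (al + be * T)) t.
Proof.
move=> T0 t0; have [m m0 E] := power_similar T0.
have d0 : 0 < al + be * T by rewrite ltr_pwDl // mulr_ge0 // ltW.
have k0 : 0 < al / (al + be * T) by rewrite divr_gt0.
rewrite /rho_shift.
have TE : [set s : R | T <= s] = `[T, +oo[%classic.
  by apply/seteqP; split=> s /=; rewrite in_itv /= andbT.
have -> : (\int[leb]_(s in [set s | (T <= s)%R]) (rho s)%:E)%E = m%:E.
  rewrite -(self_similar_tail drho T0 k0 m0 E) (integral_shift T).
  - by congr (integral _ _ _); apply/seteqP; split=> s /=; rewrite /Rplus /= lerDr.
  - by rewrite TE; exact: measurable_itv.
  - apply/measurable_EFinP; apply: measurable_funS drho.2.1; first exact: measurable_Rplus.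
    by move=> s /=; exact: le_trans.
by rewrite /= E // mulrC mulKf // gt_eqF.
Qed.

End PowerDensity.

(** Passing from all power densities to some requires one; [(1 + t)^-2] has the primitive
    [- (1 + t)^-1]. *)
Lemma power_density_exists : exists rho : R -> R, power_density rho.
Proof.
pose f := fun x : R => ((1 + x) ^+ 2)^-1.
pose rho := fun t : R => (1 + 1 * t) `^ (- 2).
have p1 (x : R) : 0 <= x -> 0 < 1 + x by move=> x0; rewrite ltr_pwDl.
have rhof (t : R) : 0 <= t -> rho t = f t.
  move=> t0; rewrite /rho /f mul1r powRN powR_mulrn // ltW //; exact: p1.
have cf (x : R) : 0 <= x -> {for x, continuous f}.
  move=> x0; apply: cvgV; first by rewrite expf_neq0 // gt_eqF // p1.
  have c1 : (1 + y : R) @[y --> x] --> (1 + x : R) by apply: cvgD; [exact: cvg_cst|exact: cvg_id].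
  by rewrite expr2; under eq_fun do rewrite expr2; apply: cvgM.
have wf : {within `[0, +oo[%classic, continuous f}.
  by apply: continuous_in_subspaceT => x /set_mem /=; rewrite in_itv /= andbT => /cf.
exists rho; split; last by exists 1, 1, 2; rewrite !ltr01 ltr0n.
split=> [t _|]; first exact: powR_ge0.
split.
  apply: (eq_measurable_fun f); first by move=> t /set_mem t0; rewrite rhof.
  rewrite RplusE; apply: subspace_continuous_measurable_fun => //; exact: measurable_itv.
rewrite (eq_integral_Rplus rhof) RplusE.
have dF (x : R) : 0 < x -> is_derive x (1 : R) (fun x : R => - (1 + x)^-1) (f x).
  move=> x0; have nz : 1 + x != 0 by rewrite gt_eqF // p1 // ltW.
  have d1 : is_derive x (1 : R) (fun x : R => 1 + x) (1 : R).
    by apply: (is_derive_eq (is_deriveD (is_derive_cst _ _ _) (is_derive_id _ _))); rewrite add0r.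
  apply: (is_derive_eq (is_deriveN (is_deriveV nz d1))).
  by rewrite /f /GRing.scale /= mulr1 opprK.
rewrite (@ge0_continuous_FTC2y _ _ (fun x => - (1 + x)^-1) 0 0) //.
- by rewrite addr0 invr1 EFinN oppeK add0e.
- by move=> x x0; rewrite /f invr_ge0 sqr_ge0.
- rewrite -oppr0; apply: cvgN; apply/gtr0_cvgV0.
    by near=> x; apply: p1; near: x; exact: nbhs_pinfty_ge.
  by apply: cvg_addrl.
- by move=> x /dF [].
- apply: cvgN; apply: cvgV; first by rewrite addr0 oner_neq0.
  by apply: cvg_at_right_filter; apply: cvgD; [exact: cvg_cst|exact: cvg_id].
- move=> x; rewrite in_itv /= andbT => /dF [_ dx].
  by rewrite derive1E dx.
Unshelve. all: by end_near. Qed.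

End Densities.

(** * Approximation by step functions *)

Section StepApproximation.
Variable R : realType.
Local Notation leb := (@lebesgue_measure R).
Local Notation seg t := [set s : R | (0 <= s <= t)%R].

(** Only [x] is confined to the segment, so a node close to [x] at which [h] is sampled need not be
    located. *)
Lemma heine_cantor (h : R -> R) (a b e : R) : continuous h -> 0 < e ->
  exists2 d : R, 0 < d & forall x y, a <= x <= b -> `|x - y| < d -> `|h x - h y| <= e.
Proof.
move=> ch e0.
have /compact_near_coveringP cov := @segment_compact R a b.
(* Compactness in its near-covering form, along small positive [d], turns local moduli of continuity
   into a common one. *)
have [|d /= d0 Hd] := cov R (0^'+) (fun d x => forall y, `|x - y| < d -> `|h x - h y| <= e) _.
  move=> x _; have e20 : 0 < e / 2 by rewrite divr_gt0.
  have /cvgrPdist_lt/(_ _ e20)/nbhs_ballP[r /= r0 Hr] := ch x.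
  have r20 : 0 < r / 2 by rewrite divr_gt0.
  exists (ball x (r / 2), [set d : R | d < r / 2]) => /=.
    split; first exact: nbhsx_ballx.
    exact: nbhs_right_lt.
  move=> [x' d] /= [xx' dr] y yd.
  have h1 : `|h x - h x'| < e / 2 by apply: Hr; apply: le_ball xx'; lra.
  have h2 : `|h x - h y| < e / 2.
    apply: Hr; rewrite /ball /= in xx' *.
    rewrite -(subrK x' x) -addrA; apply: le_lt_trans (ler_normD _ _) _.
    by rewrite [ltRHS](splitr r) ltrD // (lt_trans yd).
  rewrite -(subrK (h x) (h x')) -addrA; apply: le_trans (ler_normD _ _) _.
  by rewrite [leRHS](splitr e); apply: lerD; rewrite ltW // distrC.
have d20 : 0 < d / 2 by rewrite divr_gt0.
exists (d / 2) => // x y xab xy.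
apply: (Hd (d / 2) _ d20 x _ y xy) => /=; last by rewrite in_itv.
by rewrite sub0r normrN gtr0_norm // ltr_pdivrMr // mulr_natr mulr2n ltrDl.
Qed.

(** The offset [j] is for the induction: peeling off a step moves the start of [iota]. *)
Lemma steps_map (phi : nat -> R) (d : R) (j K : nat) (t : R) : 0 < d ->
  0 <= t <= K.+1%:R * d -> exists i : nat,
    steps d [seq phi i | i <- iota j K.+1] t = phi i /\
    (i%:R - j%:R) * d <= t <= (i%:R - j%:R + 1) * d.
Proof.
move=> d0; elim: K j t => [|K IH] j t /andP[t0 tK] /=.
  exists j; rewrite mul1r in tK; rewrite tK subrr mul0r add0r mul1r t0 tK; split=> //.
have [td|td] := leP t d.
  by exists j; rewrite subrr mul0r add0r mul1r t0 td; split.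
have [|i [Hi /andP[i1 i2]]] := IH j.+1 (t - d).
  rewrite subr_ge0 (ltW td) /= lerBlDr -[X in _ + X]mul1r -mulrDl natr1.
  exact: tK.
exists i; rewrite -Hi; split=> //.
by rewrite -natr1 in i1 i2; apply/andP; split; lra.
Qed.

Lemma steps_out (d : R) cs (t : R) : 0 < d -> (size cs)%:R * d < t -> 0 < t -> steps d cs t = 0.
Proof.
move=> d0; elim: cs t => [//|c cs IH] t /= h t0.
rewrite -natr1 mulrDl mul1r in h.
have sd : 0 <= (size cs)%:R * d by rewrite mulr_ge0 // ltW.
have td : d < t by lra.
by rewrite leNgt td /= IH //; lra.
Qed.

Lemma eq_integral_Rplus_pos (F G : R -> R) : measurable_fun (@Rplus R) F ->
  measurable_fun (@Rplus R) G -> (forall t : R, 0 < t -> F t = G t) ->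
  (\int[leb]_(t in @Rplus R) (F t)%:E = \int[leb]_(t in @Rplus R) (G t)%:E)%E.
Proof.
move=> mF mG E.
have S : `]0, +oo[%classic `<=` @Rplus R.
  by move=> t; rewrite /= in_itv /= andbT => /ltW.
rewrite RplusE -!integral_itv_obnd_cbnd.
- by apply: eq_integral => t /set_mem /=; rewrite in_itv /= andbT => t0; rewrite E.
- by apply/measurable_EFinP; apply: measurable_funS mG => //; exact: measurable_Rplus.
- by apply/measurable_EFinP; apply: measurable_funS mF => //; exact: measurable_Rplus.
Qed.

(** The integrals over [[0, n]] increase to the mass 1. *)
Lemma density_tail (mu : R -> R) (e : R) : density mu -> 0 < e ->
  exists N : nat, (\int[leb]_(t in @Rplus R) (mu (t + N.+1%:R)%R)%:E <= e%:E)%E.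
Proof.
move=> [mu0 [mmu imu]] e0.
have mS n : measurable_fun (seg n%:R) (EFin \o mu).
  apply/measurable_EFinP; apply: measurable_funS mmu; first exact: measurable_Rplus.
  exact: segS_Rplus.
have nd : nondecreasing_seq (fun n : nat => seg n%:R).
  apply/nondecreasing_seqP => n; rewrite subsetEset => t /= /andP[-> /le_trans]; apply.
  by rewrite ler_nat.
have f0 n x : seg n%:R x -> (0 <= (EFin \o mu) x)%E.
  by move=> /andP[x0 _]; rewrite lee_fin mu0.
have mseg (n : nat) := @measurable_seg R n%:R.
have cv := @ge0_nondecreasing_set_cvg_integral _ _ R _ _ leb nd mseg mS f0.
have UE : \bigcup_i seg i%:R = @Rplus R.
  apply/seteqP; split=> t; first by move=> [n _ /andP[]].
  by move=> t0; exists (Num.truncn t).+1 => //=; rewrite t0 ltW // truncnS_gt.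
rewrite UE /= imu in cv.
have /fine_cvgP[[N0 _ fin] /cvgrPdist_lt/(_ _ e0)[N1 _ H1]] := cv.
exists (maxn N0 N1); set N := (maxn N0 N1).+1.
have /= fN := fin N (leq_trans (leq_maxl _ _) (leqnSn _)).
have /= := H1 N (leq_trans (leq_maxr _ _) (leqnSn _)).
have N00 : 0 <= N%:R :> R by [].
have := ge0_integral_split N00 mmu mu0; rewrite imu.
rewrite -{1 2}(fineK fN); set x := fine _ => E h.
have -> : (\int[leb]_(t in @Rplus R) (mu (t + N%:R)%R)%:E = (1 - x)%:E)%E.
  by rewrite EFinB [1%:E]E addeAC subee // add0e.
by rewrite lee_fin; apply/ltW; apply: le_lt_trans (ler_norm _) h.
Qed.

Lemma steps_dense (mu : R -> R) (e : R) : density mu -> 0 < e ->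
  exists d cs, [/\ 0 < d, all (fun c => 0 < c) cs &
     (\int[leb]_(t in @Rplus R) `|mu t - steps d cs t|%:E <= e%:E)%E].
Proof.
move=> dmu e0; have [mu0 [mmu imu]] := dmu; have e40 : 0 < e / 4 by rewrite divr_gt0.
have [n tail] := density_tail dmu e40; set N : R := n.+1%:R in tail.
have N0 : 0 < N by rewrite ltr0n.
have mN := measurable_seg N.
have mR := @measurable_Rplus R.
have iR : leb.-integrable (@Rplus R) (EFin \o mu).
  apply/integrableP; split; first exact/measurable_EFinP.
  rewrite (eq_integral_Rplus (F := fun t => `|mu t|) (G := mu)) ?imu ?ltry // => t t0.
  by rewrite ger0_norm // mu0.
have iS : leb.-integrable (seg N) (EFin \o mu).
  by apply: integrableS iR => //; exact: segS_Rplus.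
have fN : (leb (seg N) < +oo)%E.
  by rewrite segE lebesgue_measure_itv /= lte_fin N0 sube0 ltry.
have [h_ [ch ih cvh]] := @approximation_continuous_integrable R (seg N) mu mN fN iS.
have [k] : exists k, (\int[leb]_(z in seg N) `|(mu z - h_ k z)%:E| <= (e / 4)%:E)%E.
  have /fine_cvgP[[N0' _ fin] /cvgrPdist_lt/(_ _ e40)[N1 _ H1]] := cvh.
  exists (maxn N0' N1).
  have /= fk := fin _ (leq_maxl N0' N1); have /= := H1 _ (leq_maxr N0' N1).
  by rewrite sub0r normrN -{2}(fineK fk) lee_fin => h; rewrite ltW // (le_lt_trans (ler_norm _)).
set h := h_ k => hk.
have eta0 : 0 < e / 4 / N by rewrite divr_gt0.
have [d0 d00 Hd0] := @heine_cantor h 0 N _ (ch k) eta0.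
(* Enough steps for their width [d] to be below the modulus of continuity [d0]. *)
pose K := Num.truncn (N / d0).
pose d := N / K.+1%:R.
have K0 : 0 < K.+1%:R :> R by rewrite ltr0n.
have dpos : 0 < d by rewrite divr_gt0.
have dd0 : d < d0.
  rewrite /d ltr_pdivrMr // mulrC -ltr_pdivrMr //; exact: truncnS_gt.
(* Heights sample [h] at right end points. Cutting at 0 does not move them away from [mu >= 0]; the
   added constant makes them positive and costs [e / 4] in L1. *)
pose phi (i : nat) := Num.max (h ((i%:R + 1) * d)) 0 + e / 4 / N.
pose cs := [seq phi i | i <- iota 0 K.+1].
have cs0 : all (fun c => 0 < c) cs.
  apply/allP => c /mapP[i _ ->]; rewrite ltr_wpDl // le_max lexx orbT //.
have KdN : K.+1%:R * d = N by rewrite /d mulrC divfK // gt_eqF.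
have szcs : (size cs)%:R * d = N by rewrite size_map size_iota.
exists d, cs; split=> //.
have [_ [ms _]] := weight_steps dpos cs0.
have mabs : measurable_fun (@Rplus R) (fun t => `|mu t - steps d cs t|).
  by apply: measurableT_comp => //; exact: measurable_funB.
rewrite (ge0_integral_split (ltW N0) mabs) //.
(* Four equal shares: the approximation by [h], its oscillation on a step, the added constant, and
   the tail beyond [N]. *)
have -> : e = e / 4 + e / 4 + e / 4 + e / 4 by field.
rewrite EFinD; apply: leeD; last first.
  apply: le_trans tail; rewrite le_eqVlt; apply/orP; left; apply/eqP.
  apply: eq_integral_Rplus_pos.
  - exact: measurable_shift (ltW N0) mabs.
  - exact: measurable_shift (ltW N0) mmu.
  move=> t t0; have tN0 : 0 < t + N by rewrite addr_gt0.
  by rewrite steps_out // ?szcs ?ltrDr // subr0 ger0_norm // mu0 // ltW.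
have mh : measurable_fun (seg N) (fun t => `|mu t - h t|).
  apply: measurableT_comp => //; apply: measurable_funB.
    by apply: measurable_funS mmu; [exact: measurable_Rplus|exact: segS_Rplus].
  by apply: measurable_funTS; apply: continuous_measurable_fun; exact: ch.
have pt t : seg N t -> `|mu t - steps d cs t| <= `|mu t - h t| + 2 * (e / 4 / N).
  move=> tN; have /andP[t0 _] := tN; have tK : 0 <= t <= K.+1%:R * d by rewrite KdN.
  have [i [-> /andP[i1 i2]]] := @steps_map phi d 0 K t dpos tK.
  rewrite subr0 in i1 i2.
  have c1 : `|t - (i%:R + 1) * d| < d0.
    by apply: le_lt_trans dd0; rewrite ler_norml; apply/andP; split; lra.
  have := Hd0 t _ tN c1; set y := h ((_ + 1) * d); rewrite /phi -/y => hy.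
  have m0 := mu0 t t0.
  have h1 : `|mu t - Num.max y 0| <= `|mu t - y|.
    rewrite maxEle; case: ifP => // y0; rewrite subr0 ger0_norm // ger0_norm; last by rewrite subr_ge0 (le_trans y0).
    by rewrite lerDl oppr_ge0.
  rewrite opprD addrA; apply: le_trans (ler_normB _ _) _.
  rewrite (gtr0_norm eta0) mulr_natl mulr2n addrA lerD2r.
  apply: le_trans h1 _; have -> : mu t - y = (mu t - h t) + (h t - y) by ring.
  by apply: le_trans (ler_normD _ _) _; rewrite lerD2l.
pose J : \bar R := (\int[leb]_(t in seg N) (`|mu t - h t|%:E + (2 * (e / 4 / N))%:E))%E.
apply: (@le_trans _ _ J).
  apply: ge0_le_integral => //.
  - apply/measurable_EFinP; apply: measurable_funS mabs; [exact: measurable_Rplus|exact: segS_Rplus].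
  - by apply: emeasurable_funD => //; exact/measurable_EFinP.
rewrite /J ge0_integralD //; first last.
- by move=> t _; rewrite lee_fin mulr_ge0 // ltW.
- exact/measurable_EFinP.
rewrite (integral_seg_cst _ (ltW N0)) -[in leRHS]addrA [in leRHS]EFinD.
have hk' : (\int[leb]_(t in seg N) `|mu t - h t|%:E <= (e / 4)%:E)%E by exact: hk.
apply: (leeD hk'); rewrite lee_fin le_eqVlt; apply/orP; left; apply/eqP; field.
by rewrite gt_eqF.
Qed.

End StepApproximation.

(** * Uniform limits in epsilon form *)

Section UniformConvergence.
Variable R : realType.

(** A point of [Om] keeps the supremum nonnegative, where an empty one would be [-oo]; finiteness is
    then needed only eventually. *)
Lemma sup_dev_cvgP n (Om : set 'rV[R]_n) (F : set_system R) (G : R -> 'rV[R]_n -> R) U :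
  Filter F -> Om !=set0 ->
  ((fun l => sup_dev Om (G l) U) @ F --> 0%E) <->
  forall e : R, 0 < e -> \forall l \near F, forall w, Om w -> `|G l w - U w| <= e.
Proof.
move=> FF [w0 Ow0].
have ge0 l : (0 <= sup_dev Om (G l) U)%E.
  apply: (@le_trans _ _ (`|G l w0 - U w0|%:E)); first by rewrite lee_fin.
  by apply: ereal_sup_ubound; exists w0.
have le e l : (forall w, Om w -> `|G l w - U w| <= e) -> (sup_dev Om (G l) U <= e%:E)%E.
  by move=> H; apply: ge_ereal_sup => _ [w Ow <-]; rewrite lee_fin H.
split=> [/fine_cvgP[fin /cvgrPdist_le cv] e e0|H].
  apply: filterS2 fin (cv e e0) => l /= fl; rewrite sub0r normrN => hl w Ow.
  rewrite -lee_fin (@le_trans _ _ (sup_dev Om (G l) U)) //.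
    by apply: ereal_sup_ubound; exists w.
  by rewrite -(fineK fl) lee_fin (le_trans (ler_norm _)).
apply/fine_cvgP; split.
  apply: filterS (H 1 ltr01) => l Hl /=.
  by rewrite ge0_fin_numE // (le_lt_trans (le _ _ Hl)) // ltry.
apply/cvgrPdist_le => e e0; apply: filterS (H e e0) => l Hl /=.
have fl : sup_dev Om (G l) U \is a fin_num.
  by rewrite ge0_fin_numE // (le_lt_trans (le _ _ Hl)) // ltry.
by rewrite sub0r normrN ger0_norm ?fine_ge0 // -lee_fin fineK // le.
Qed.

Lemma sup_dev_cvg0P n (Om : set 'rV[R]_n) (G : R -> 'rV[R]_n -> R) U : Om !=set0 ->
  ((fun l => sup_dev Om (G l) U) @ 0^'+ --> 0%E) <-> lim0 Om G U.
Proof.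
move=> O0; rewrite sup_dev_cvgP //; split=> H e e0.
  have [d /= d0 Hd] := H e e0; exists d => // l /andP[l0 ld] w Ow.
  by apply: (Hd l) => //=; rewrite sub0r normrN gtr0_norm.
have [d d0 Hd] := H e e0; exists d => //= l; rewrite /ball_ /= sub0r normrN => ld l0 w Ow.
by apply: Hd => //; rewrite l0 -(gtr0_norm l0).
Qed.

Lemma sup_dev_cvgyP n (Om : set 'rV[R]_n) (G : R -> 'rV[R]_n -> R) U : Om !=set0 ->
  ((fun T => sup_dev Om (G T) U) @ +oo --> 0%E) <-> limoo Om G U.
Proof.
move=> O0; rewrite sup_dev_cvgP //; split=> H e e0.
  by have [T [_ HT]] := H e e0; exists T => T' TT' w Ow; exact: HT.
have [T HT] := H e e0; exists T; split; first exact: num_real.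
by move=> T' TT' w Ow; exact: HT.
Qed.

End UniformConvergence.

Theorem theorem4 (R : realType) (n p q : nat)
  (A : set 'rV[R]_p) (B : set 'rV[R]_q)
  (f : 'rV[R]_n -> 'rV[R]_p -> 'rV[R]_q -> 'rV[R]_n)
  (g : 'rV[R]_n -> 'rV[R]_p -> 'rV[R]_q -> R)
  (Om : set 'rV[R]_n) :
  A !=set0 -> compact A -> B !=set0 -> compact B ->
  {within [set z : 'rV[R]_n * 'rV[R]_p * 'rV[R]_q | A z.1.2 /\ B z.2],
     continuous (fun z => f z.1.1 z.1.2 z.2)} ->
  {within [set z : 'rV[R]_n * 'rV[R]_p * 'rV[R]_q | A z.1.2 /\ B z.2],
     continuous (fun z => g z.1.1 z.1.2 z.2)} ->
  (forall x a b, A a -> B b -> 0 <= g x a b <= 1) ->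
  (exists L : R, 0 < L /\ forall x y a b, A a -> B b ->
     `|f x a b - f y a b| + `|g x a b - g y a b| <= L * `|x - y|) ->
  Om !=set0 ->
  (forall x0 a b t, Om x0 -> control A a -> control B b -> 0 <= t ->
     Om (traj f x0 a b t)) ->
  let V := value A B f g in
  let Cc U := forall mu : R -> R, density mu -> piecewise_continuous mu ->
      (fun lam => sup_dev Om (V (rho_scale mu lam)) U) @ 0^'+ --> 0%E in
  let Cu U := (fun T => sup_dev Om (V (varpi T)) U) @ +oo --> 0%E in
  let Ce U := (fun lam => sup_dev Om (V (pi_exp lam)) U) @ 0^'+ --> 0%E in
  let Cp rho U := (fun T => sup_dev Om (V (rho_shift rho T)) U) @ +oo --> 0%E in
  (forall U : 'rV[R]_n -> R, (forall w, Om w -> 0 <= U w <= 1) ->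
     (Cc U <-> Cu U) /\ (Cu U <-> Ce U) /\
     (Ce U <-> (exists rho : R -> R, power_density rho /\ Cp rho U)) /\
     ((exists rho : R -> R, power_density rho /\ Cp rho U) <->
        (forall rho : R -> R, power_density rho -> Cp rho U))) /\
  (forall mu rho : R -> R, density mu -> piecewise_continuous mu -> power_density rho ->
     (exists U : 'rV[R]_n -> R, Cu U \/ Ce U \/ Cp rho U) ->
     exists U : 'rV[R]_n -> R,
       (forall mu' : R -> R, density mu' -> piecewise_continuous mu' ->
          (fun lam => sup_dev Om (V (rho_scale mu' lam)) U) @ 0^'+ --> 0%E) /\
       Cu U /\ Ce U /\ (forall rho' : R -> R, power_density rho' -> Cp rho' U)).
Proof.
move=> A0 cA B0 cB cf cg g01 [L [L0 HL]] O0 inv V Cc Cu Ce Cp.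
have fL x y a b : A a -> B b -> `|f x a b - f y a b| <= L * `|x - y|.
  by move=> Aa Bb; apply: le_trans (HL x y a b Aa Bb); rewrite lerDl.
have Vge0 := @value_ge0 R n p q A B f g L cA cB cf cg g01 L0 fL A0 B0.
have Veq := @value_eq R n p q A B f g.
have Vhom := @value_homogeneous R n p q A B f g L cA cB cf cg g01 L0 fL A0 B0.
have Vlip := @value_lipschitz R n p q A B f g L cA cB cf cg g01 L0 fL A0 B0.
have Vstep := @value_compare_step R n p q A B f g L cA cB cf cg g01 L0 fL A0 B0 Om inv.
rewrite -/V in Vge0 Veq Vhom Vlip Vstep.
(* Every implication is routed through the uniform densities. *)
have CuP U : Cu U <-> limoo Om (fun T => V (varpi T)) U by exact: sup_dev_cvgyP.
have abelU U mu : Cu U -> density mu ->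
    (fun lam => sup_dev Om (V (rho_scale mu lam)) U) @ 0^'+ --> 0%E.
  move=> /CuP H dmu; apply/(sup_dev_cvg0P _ _ O0).
  by apply: (abel Vge0 Veq Vhom Vlip Vstep H dmu) => e e0; exact: steps_dense.
have CcCu U : Cc U -> Cu U.
  move=> /(_ _ (varpi1_density R) (@varpi1_piecewise_continuous R)).
  move=> /(sup_dev_cvg0P _ _ O0) H; apply/CuP => e e0.
  have [d d0 Hd] := H e e0; exists d^-1 => T dT w Ow.
  have T0 : 0 < T by apply: lt_trans dT; rewrite invr_gt0.
  rewrite (Veq _ (rho_scale (varpi 1) T^-1)); last by move=> t t0; exact: varpi_scale.
  by apply: Hd => //; rewrite invr_gt0 T0 invf_plt ?posrE.
have CeCu U : Ce U -> Cu U.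
  move=> /(sup_dev_cvg0P _ _ O0) H; apply/CuP.
  apply: (tauber Vge0 Veq Vhom Vlip Vstep (exp_densityP R) ltr01 ler01
    (@exp_density_bounds R) (@exp_density_self_similar R)).
  exact: H.
have CuCe U : Cu U -> Ce U by move=> H; exact: (abelU U _ H (exp_densityP R)).
have CpCu rho U : power_density rho -> Cp rho U -> Cu U.
  move=> [drho [al [be [ga [al0 [be0 [ga0 rhoE]]]]]]] /(sup_dev_cvgyP _ _ O0) H; apply/CuP.
  apply: (@tauber R _ Om V Vge0 Veq Vhom Vlip Vstep U rho (al `^ (- ga)) (ga * be / al) drho).
  - exact: powR_gt0.
  - by rewrite divr_ge0 // ?mulr_ge0 // ltW.
  - exact: power_bounds.
  - exact: (power_self_similar al0 be0 rhoE).
  move=> e e0; have [T0 HT] := H e e0.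
  (* Large [T] becomes small [l] by solving [al / (al + be * T) = l]; the threshold for [l] is the
     left side at [T1], a positive time beyond [T0]. *)
  pose T1 := `|T0| + 1; have T10 : 0 < T1 by rewrite ltr_wpDl.
  have dT1 : 0 < al + be * T1 by rewrite addr_gt0 // mulr_gt0.
  exists (al / (al + be * T1)); first by rewrite divr_gt0.
  move=> l /andP[l0 ld] w Ow.
  pose T := (al / l - al) / be.
  have TT1 : T1 < T.
    rewrite /T ltr_pdivlMr // ltrBrDr addrC ltr_pdivlMr //.
    by rewrite ltr_pdivlMr // in ld; rewrite mulrC (mulrC T1).
  have T00 : 0 < T by exact: lt_trans TT1.
  have lE : al / (al + be * T) = l.
    have -> : al + be * T = al / l by rewrite /T mulrC divfK ?gt_eqF // addrC subrK.
    by rewrite invf_div mulrCA mulfV ?mulr1 // gt_eqF.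
  rewrite (Veq _ (rho_shift rho T)).
    apply: HT => //; apply: le_lt_trans TT1; apply: le_trans (ler_norm _) _.
    by rewrite /T1 lerDl.
  by move=> t t0; rewrite (power_shift al0 be0 rhoE drho (ltW T00) t0) lE.
have CuCp rho U : power_density rho -> Cu U -> Cp rho U.
  move=> [drho [al [be [ga [al0 [be0 [ga0 rhoE]]]]]]] /abelU/(_ drho).
  move=> /(sup_dev_cvg0P _ _ O0) H; apply/(sup_dev_cvgyP _ _ O0) => e e0.
  (* Beyond this threshold [al / (al + be * T) < al / (be * T) < d]. *)
  have [d d0 Hd] := H e e0; exists (al / (d * be)) => T hT w Ow.
  have T0 : 0 < T by apply: lt_trans hT; rewrite divr_gt0 // mulr_gt0.
  have dT : 0 < al + be * T by rewrite addr_gt0 // mulr_gt0.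
  rewrite (Veq _ (rho_scale rho (al / (al + be * T)))).
    apply: Hd => //; rewrite divr_gt0 //= ltr_pdivrMr //.
    move: hT; rewrite ltr_pdivrMr ?mulr_gt0 // => hT.
    have : 0 < d * al by rewrite mulr_gt0.
    by lra.
  by move=> t t0; exact: (power_shift al0 be0 rhoE drho (ltW T0) t0).
have [rho0 prho0] := power_density_exists R.
split=> [U _|mu rho _ _ prho [U HU]].
  split; first by split=> [H|H mu dmu _]; [exact (CcCu U H)|exact (abelU U mu H dmu)].
  split; first by split=> H; [exact (CuCe U H)|exact (CeCu U H)].
  split.
    split=> [H|[rho [prho H]]]; last exact (CuCe U (CpCu rho U prho H)).
    by exists rho0; split; [exact prho0|exact (CuCp rho0 U prho0 (CeCu U H))].
  split=> [[rho [prho H]] rho' prho'|H].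
    exact (CuCp rho' U prho' (CpCu rho U prho H)).
  by exists rho0; split; [exact prho0|exact (H rho0 prho0)].
have cu : Cu U.
  by case: HU => [H|[H|H]]; [exact H|exact (CeCu U H)|exact (CpCu rho U prho H)].
exists U; split; first by move=> mu' dmu' _; exact (abelU U mu' cu dmu').
split; first exact cu.
by split; [exact (CuCe U cu)|move=> rho' prho'; exact (CuCp rho' U prho' cu)].
Qed.
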